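(* Consider the instrumental-variables model described in the context, with $\pi_1\neq 0$, under Assumption B. Let $(\lambda_n)$ satisfy $\lambda_n=o(\sqrt n)$. Then the ridge IV estimator \[ \hat\beta_{\text{ridge}} = \frac{\sum_{i=1}^n (Y_i-\bar Y)(Z_i-\bar Z)}{\sum_{i=1}^n (D_i-\bar D)(Z_i-\bar Z) + \lambda_n} \] is asymptotically normal with \[ \sqrt n\left(\hat\beta_{\text{ridge}}-\beta_1\right) \xrightarrow{d} \mathcal N\!\left(0,\ \frac{\sigma_\epsilon^2}{\pi_1^2}\right). \]
   Context: Data model: for each sample size $n$, observations $(Y_i,D_i,Z_i)$, $i=1,\dots,n$, satisfy $Y_i=\beta_0+\beta_1 D_i+\epsilon_i$ and $D_i=\pi_0+\pi_1 Z_i+\eta_i$, where the error pairs $(\epsilon_i,\eta_i)$ are i.i.d. across $i$ with mean zero, $\mathrm{Var}(\epsilon_i)=\sigma_\epsilon^2<\infty$, $\mathrm{Var}(\eta_i)=\sigma_\eta^2<\infty$ and $\mathrm{Cov}(\epsilon_i,\eta_i)=\sigma_{\epsilon\eta}$ (the errors may be correlated). Bars denote sample means. The penalty $\lambda_n$ is a deterministic sequence of nonnegative reals. Assumption B (stochastic instruments): the $Z_i$ are i.i.d. random variables, independent of the errors, with $\mathrm{Var}(Z_i)=1$ and finite fourth moment $m_4=E[Z_i^4]$. *)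

(* Defs.v *)
From HB Require Import structures.
From mathcomp Require Import all_boot all_order all_algebra.
From mathcomp Require Import all_classical all_reals all_analysis.
Set Implicit Arguments.
Unset Strict Implicit.
Unset Printing Implicit Defensive.
Import Order.TTheory GRing.Theory Num.Theory.
Import numFieldNormedType.Exports.
Local Open Scope classical_set_scope.
Local Open Scope ring_scope.

Definition mutually_independent {d} {T : measurableType d} {R : realType}
  (P : probability T R) {I : eqType} {dV} {V : measurableType dV}
  (X : I -> T -> V) : Prop :=
  forall (s : seq I) (B : I -> set V), uniq s ->
    (forall i, measurable (B i)) ->
    P (\big[setI/setT]_(i <- s) (X i @^-1` B i)) =
    (\prod_(i <- s) fine (P (X i @^-1` B i)))%:E.

Definition independent2 {d} {T : measurableType d} {R : realType}
  (P : probability T R) {d1 d2} {V1 : measurableType d1} {V2 : measurableType d2}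
  (X : T -> V1) (Y : T -> V2) : Prop :=
  forall (A : set V1) (B : set V2), measurable A -> measurable B ->
    P (X @^-1` A `&` Y @^-1` B) = (fine (P (X @^-1` A)) * fine (P (Y @^-1` B)))%:E.

Definition identically_distributed {d} {T : measurableType d} {R : realType}
  (P : probability T R) {dV} {V : measurableType dV} (X : nat -> T -> V) : Prop :=
  forall (i : nat) (B : set V), measurable B -> P (X i @^-1` B) = P (X 0 @^-1` B).

(* E[f(G)] for G ~ N(0, v), v >= 0 (v = 0 gives the point mass at 0):
   G = sqrt v * N with N standard normal. *)
Definition gauss_expect {R : realType} (v : R) (f : R -> R) : \bar R :=
  (\int[lebesgue_measure]_x (f (Num.sqrt v * x) * normal_pdf 0 1 x)%:E)%E.

Definition cvg_in_law_normal0 {d} {T : measurableType d} {R : realType}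
  (P : probability T R) (X : nat -> T -> R) (v : R) : Prop :=
  forall f : R -> R, continuous f -> (exists M : R, forall x, `|f x| <= M) ->
    ('E_P[f \o X n])%E @[n --> \oo] --> gauss_expect v f.

Definition smean {T : Type} {R : realType} (n : nat) (X : nat -> T -> R) (t : T) : R :=
  (\sum_(i < n) X i t) / n%:R.

Definition scross {T : Type} {R : realType} (n : nat) (A B : nat -> T -> R) (t : T) : R :=
  \sum_(i < n) (A i t - smean n A t) * (B i t - smean n B t).

Definition ridge_iv {T : Type} {R : realType} (lam : nat -> R)
  (Y D Z : nat -> T -> R) (n : nat) (t : T) : R :=
  scross n Y Z t / (scross n D Z t + lam n).

(* Main.v *)
Require Import Defs.
From HB Require Import structures.
From mathcomp Require Import all_boot all_order all_algebra.
From mathcomp Require Import all_classical all_reals all_analysis.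
From mathcomp Require Import measurable_realfun ring lra.
Import Order.TTheory GRing.Theory Num.Theory.
Import numFieldNormedType.Exports.
Local Open Scope classical_set_scope.
Local Open Scope ring_scope.

(** The theorem reduces to a central limit theorem for the i.i.d. variables
    [W_i = eps_i (Z_i - E Z) / pi1].  After centring, [sqrt n (ridge - beta1)]
    is a quotient whose numerator is [sum_i eps_i (Z_i - E Z) / sqrt n] up to
    [o_P(1)] (this uses [lam n = o(sqrt n)]) and whose denominator is
    [pi1 + o_P(1)]; every remainder is a sample mean of centred
    square-integrable variables and is controlled by Chebyshev's inequality.
    The central limit theorem is proved by Lindeberg's replacement argument:
    the summands are exchanged one at a time for Gaussians, the stability of
    the Gaussian law under convolution identifies the fully exchanged sum, and
    each exchange costs only second-order Taylor remainders, whose total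
    vanishes by dominated convergence.  Uniformly continuous test functions are
    made twice differentiable by averaging over short windows, and tightness
    extends the limit from them to all bounded continuous functions. *)

Set Implicit Arguments.
Unset Strict Implicit.
Unset Printing Implicit Defensive.

(** * Integration on a probability space *)

(** The Gaussians of the replacement argument never live on the probability space of the data. A
    Gaussian summand is integrated out as soon as it appears: it acts on test functions through
    [expected_shift], and all Gaussians not yet exchanged fuse into one such operator. No enlarged
    probability space has to be built, and of the independence of the summands the argument consumes
    only that of a partial sum from the next term. The second obstacle is the quotient. Division is
    total, so the formula for the estimation error holds only where the denominator is nonzero; the
    points where it may fail are absorbed into an event of small probability. *)

Section real_integrable.
Context {d} {T : measurableType d} {R : realType}.
Variable mu : {measure set T -> \bar R}.
Implicit Types f g : T -> R.

Lemma integrable_EFinZ f (r : R) : mu.-integrable setT (EFin \o f) ->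
  mu.-integrable setT (EFin \o (fun x => r * f x)).
Proof. by move=> /(integrableZl measurableT r); apply: eq_integrable. Qed.

Lemma integrable_EFinD f g : mu.-integrable setT (EFin \o f) ->
  mu.-integrable setT (EFin \o g) ->
  mu.-integrable setT (EFin \o (fun x => f x + g x)).
Proof. by move=> fi /(integrableD measurableT fi); apply: eq_integrable. Qed.

Lemma integrable_EFinB f g : mu.-integrable setT (EFin \o f) ->
  mu.-integrable setT (EFin \o g) ->
  mu.-integrable setT (EFin \o (fun x => f x - g x)).
Proof. by move=> fi /(integrableB measurableT fi); apply: eq_integrable. Qed.

Lemma integrable_EFin_sum (I : Type) (s : seq I) (F : I -> T -> R) :
  (forall i, mu.-integrable setT (EFin \o F i)) ->
  mu.-integrable setT (EFin \o (fun x => \sum_(i <- s) F i x)).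
Proof.
move=> Fi; elim: s => [|i s IH].
  by apply: eq_integrable (integrable0 _ _) => // x _; rewrite /= big_nil.
apply: eq_integrable (integrable_EFinD (Fi i) IH) => // x _.
by rewrite /= big_cons.
Qed.

Lemma le_integrable_EFin f g : measurable_fun setT f ->
  (forall x, `|f x| <= g x) -> mu.-integrable setT (EFin \o g) ->
  mu.-integrable setT (EFin \o f).
Proof.
move=> mf fg; apply: le_integrable => //; first exact/measurable_EFinP.
by move=> x _ /=; rewrite lee_fin (le_trans (fg x))// ler_norm.
Qed.

Lemma integrable_EFin_measurable f : mu.-integrable setT (EFin \o f) ->
  measurable_fun setT f.
Proof. by move=> /measurable_int/measurable_EFinP. Qed.

End real_integrable.

Section bounded_integration.
Context {d} {T : measurableType d} {R : realType} (P : probability T R).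
Implicit Types f g : T -> R.

Lemma bounded_integrable f (M : R) : measurable_fun setT f ->
  (forall x, `|f x| <= M) -> P.-integrable setT (EFin \o f).
Proof.
move=> mf fM; apply: measurable_bounded_integrable => //.
  by rewrite (le_lt_trans (probability_le1 P measurableT)) ?ltry.
exists M; split; first exact: num_real.
by move=> x Mx t _ /=; rewrite (le_trans (fM t)) ?ltW.
Qed.

Lemma Rintegral_prob_cst (r : R) : \int[P]_x r = r.
Proof.
have := @Rintegral_cst _ _ _ P setT measurableT r.
by rewrite [X in fine X]probability_setT/= mulr1.
Qed.

Lemma le_normr_Rintegral_bound f g : P.-integrable setT (EFin \o f) ->
  P.-integrable setT (EFin \o g) -> (forall x, `|f x| <= g x) ->
  `|\int[P]_x f x| <= \int[P]_x g x.
Proof.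
move=> fi gi fg; apply: le_trans (le_normr_Rintegral _ fi) _ => //.
by apply: le_Rintegral => //; exact: integrable_norm.
Qed.

Lemma normr_Rintegral_le f (M : R) : measurable_fun setT f ->
  (forall x, `|f x| <= M) -> `|\int[P]_x f x| <= M.
Proof.
move=> mf fM; have fi := bounded_integrable mf fM.
rewrite -[leRHS]Rintegral_prob_cst; apply: le_normr_Rintegral_bound => //.
by apply: (@bounded_integrable _ `|M|).
Qed.

Lemma Rintegral_indic (A : set T) : measurable A ->
  \int[P]_x (\1_A x) = fine (P A).
Proof. by move=> mA; rewrite /Rintegral integral_indic// setIT. Qed.

Lemma integrable_indic (A : set T) : measurable A ->
  P.-integrable setT (EFin \o (\1_A : T -> R)).
Proof.
move=> mA; apply: (@bounded_integrable _ 1); first exact: measurable_indic.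
by move=> x; rewrite indicE; case: (_ \in _); rewrite ?normr1 ?normr0.
Qed.

(** Turns closeness outside a rare event into closeness of expectations: the event contributes at
    most [2 * M] times its probability. The case [e = 0] serves truncation, the case [e > 0]
    Slutsky's lemma. *)
Lemma Rintegral_dist_off_event f g (A : set T) (M e c : R) :
  measurable_fun setT f -> measurable_fun setT g -> measurable A ->
  (forall x, `|f x| <= M) -> (forall x, `|g x| <= M) -> 0 <= e ->
  (P A <= c%:E)%E -> (forall x, ~ A x -> `|f x - g x| <= e) ->
  `|\int[P]_x f x - \int[P]_x g x| <= e + 2 * M * c.
Proof.
move=> mf mg mA fM gM e0 PA fge.
have fi := bounded_integrable mf fM; have gi := bounded_integrable mg gM.
have M0 : 0 <= M by rewrite (le_trans _ (fM point)).
have i1 : P.-integrable setT (EFin \o (fun x => 2 * M * \1_A x : R)).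
  exact/integrable_EFinZ/integrable_indic.
have i2 : P.-integrable setT (EFin \o (fun x => e)).
  by apply: (@bounded_integrable _ `|e|).
have i3 : P.-integrable setT (EFin \o (fun x => e + 2 * M * \1_A x : R)).
  exact: integrable_EFinD.
rewrite -RintegralB//.
apply: le_trans (le_normr_Rintegral_bound (g :=
  fun x => e + 2 * M * \1_A x) _ _ _) _ => //.
- exact: integrable_EFinB.
- move=> x; rewrite indicE; case: (boolP (x \in A)) => xA.
    rewrite mulr1; apply: le_trans (ler_normB _ _) _.
    by have := fM x; have := gM x; lra.
  by rewrite mulr0 addr0 fge//; move: xA; rewrite notin_setE.
rewrite RintegralD// Rintegral_prob_cst RintegralZl//; last exact: integrable_indic.
rewrite lerD2l ler_wpM2l ?mulr_ge0// Rintegral_indic// -lee_fin fineK//.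
exact: fin_num_measure.
Qed.

End bounded_integration.

(** * Independence *)

Section independent_pair.
Context {d d1 d2} {T : measurableType d} {V1 : measurableType d1}
  {V2 : measurableType d2} {R : realType} (P : probability T R).

(** Independence is stated on rectangles only; uniqueness of the product measure carries it to the
    whole product sigma-algebra. *)
Lemma independent2_law (X : {mfun T >-> V1}) (Y : {mfun T >-> V2})
    (XY : {mfun T >-> (V1 * V2)%type}) :
  XY = (fun t => (X t, Y t)) :> (T -> V1 * V2) -> independent2 P X Y ->
  forall C, measurable C ->
  (distribution P X \x distribution P Y)%E C = distribution P XY C.
Proof.
move=> XYE iXY; apply: product_measure_unique => A B mA mB.
rewrite -[LHS]/(P (XY @^-1` (A `*` B))) XYE.
rewrite -[X in _ = (X * _)%E]/(P (X @^-1` A)) -[X in _ = (_ * X)%E]/(P (Y @^-1` B)).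
rewrite (_ : _ @^-1` _ = X @^-1` A `&` Y @^-1` B); last by apply/seteqP; split.
rewrite iXY// EFinM !fineK//; apply: fin_num_measure.
  by rewrite -[_ @^-1` _]setTI; exact: measurable_funPT.
by rewrite -[_ @^-1` _]setTI; exact: measurable_funPT.
Qed.

Lemma ge0_integral_independent2 (X : T -> V1) (Y : T -> V2)
    (h : V1 * V2 -> \bar R) :
  measurable_fun setT X -> measurable_fun setT Y -> independent2 P X Y ->
  measurable_fun setT h -> (forall z, 0 <= h z)%E ->
  (\int[P]_t h (X t, Y t) = \int[P]_t \int[P]_u h (X t, Y u))%E.
Proof.
move=> mX mY iXY mh h0.
pose X' := mfun_Sub (mem_set mX); pose Y' := mfun_Sub (mem_set mY).
pose XY := mfun_Sub (mem_set (measurable_fun_pair mX mY)).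
have law := @independent2_law X' Y' XY erefl iXY.
have E1 := @ge0_integral_distribution _ _ _ _ _ P XY h mh h0.
transitivity (\int[distribution P XY]_z h z)%E; first by rewrite E1.
rewrite (eq_measure_integral (distribution P X' \x distribution P Y')%E); last first.
  by move=> A mA _; rewrite [RHS]law.
rewrite fubini_tonelli1// (@ge0_integral_distribution _ _ _ _ _ P X')//; first last.
- by move=> x; apply: integral_ge0.
- exact: measurable_fun_fubini_tonelli_F.
apply: eq_integral => t _; rewrite /= /fubini_F.
rewrite (@ge0_integral_distribution _ _ _ _ _ P Y')//.
exact: measurableT_comp mh (pair1_measurable _).
Qed.

(** Fubini for the product law. Integrability of every section makes the inner [fine] exact at every
    point, so that it coincides with [fubini_F]. *)
Lemma Rintegral_independent2 (X : T -> V1) (Y : T -> V2) (h : V1 * V2 -> R) :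
  measurable_fun setT X -> measurable_fun setT Y -> independent2 P X Y ->
  measurable_fun setT h ->
  P.-integrable setT (EFin \o (fun t => h (X t, Y t))) ->
  (forall x, P.-integrable setT (EFin \o (fun t => h (x, Y t)))) ->
  \int[P]_t h (X t, Y t) = \int[P]_t \int[P]_u h (X t, Y u).
Proof.
move=> mX mY iXY mh hi hix.
pose X' := mfun_Sub (mem_set mX); pose Y' := mfun_Sub (mem_set mY).
pose XY := mfun_Sub (mem_set (measurable_fun_pair mX mY)).
have law := @independent2_law X' Y' XY erefl iXY.
have mEh : measurable_fun setT (EFin \o h) by exact/measurable_EFinP.
have E1 := @integral_distribution _ _ _ _ _ P XY (EFin \o h) mEh hi.
have hiXY : (distribution P XY).-integrable setT (EFin \o h).
  by apply: integrable_pushforward.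
have hiprod : (distribution P X' \x distribution P Y')%E.-integrable setT (EFin \o h).
  apply/integrableP; split => //.
  rewrite (eq_measure_integral (distribution P XY)); last first.
    by move=> A mA _; rewrite [LHS]law.
  by have /integrableP[] := hiXY.
have FE x : fubini_F (distribution P Y') (EFin \o h) x =
    (\int[P]_u h (x, Y u))%:E.
  rewrite /fubini_F (@integral_distribution _ _ _ _ _ P Y')//.
  - by rewrite /Rintegral fineK//; exact: integrable_fin_num (hix x).
  - by apply/measurable_EFinP; exact: measurableT_comp mh (pair1_measurable _).
  - exact: hix.
rewrite /Rintegral; congr fine.
transitivity (\int[distribution P XY]_z (h z)%:E)%E; first by rewrite E1.
rewrite (eq_measure_integral (distribution P X' \x distribution P Y')%E); last first.
  by move=> A mA _; rewrite [RHS]law.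
rewrite -integral12_prod_meas1//.
have mF : measurable_fun setT (fun x => (\int[P]_u h (x, Y u))%:E).
  rewrite (_ : (fun _ => _) = fubini_F (distribution P Y') (EFin \o h)).
    exact: (measurable_fubini_F (m1 := distribution P X')).
  by apply/funext => x; rewrite FE.
have /= ip := integrable_fubini_F hiprod.
have ip' : (distribution P X').-integrable setT (fun x => (\int[P]_u h (x, Y u))%:E).
  by apply: eq_integrable ip => // x _; rewrite FE.
rewrite (eq_integral (fun x => (\int[P]_u h (x, Y u))%:E)); last by move=> x _;
  exact: FE.
rewrite (@integral_distribution _ _ _ _ _ P X')//.
have /integrableP[_ ipoo] := ip'.
apply/integrableP; split; first exact: measurableT_comp mF mX.
by rewrite -(@ge0_integral_distribution _ _ _ _ _ P X' (fun x =>
  `|(\int[P]_u h (x, Y u))%:E|)%E)//;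
  exact: measurableT_comp.
Qed.

End independent_pair.

Section independence_theory.
Context {d} {T : measurableType d} {R : realType} (P : probability T R).

(** By Tonelli the integral of [|X Y|] is the product of those of [|X|] and [|Y|], so first moments
    are enough. Applied to squares, this gives [eps * z] a second moment from second moments
    alone. *)
Lemma independent2_integrableM (X Y : T -> R) : independent2 P X Y ->
  P.-integrable setT (EFin \o X) -> P.-integrable setT (EFin \o Y) ->
  P.-integrable setT (EFin \o (fun t => X t * Y t)).
Proof.
move=> iXY Xi Yi.
have mX := integrable_EFin_measurable Xi.
have mY := integrable_EFin_measurable Yi.
apply/integrableP; split; first exact/measurable_EFinP/measurable_funM.
have mh : measurable_fun setT (fun z : R * R => `|z.1 * z.2|%:E).
  by apply/measurable_EFinP; apply: measurableT_comp => //; exact: measurable_funM.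
have := @ge0_integral_independent2 _ _ _ _ _ _ _ P X Y _ mX mY iXY mh.
move=> /(_ (fun z => normr_ge0 _)) ->.
have mnY : measurable_fun setT (fun t => `|Y t|%:E).
  by apply/measurable_EFinP; exact: measurableT_comp.
have mnX : measurable_fun setT (fun t => `|X t|%:E).
  by apply/measurable_EFinP; exact: measurableT_comp.
have E t : (\int[P]_u `|(X t, Y u).1 * (X t, Y u).2|%:E =
    `|X t|%:E * \int[P]_u `|Y u|%:E)%E.
  under eq_integral do rewrite /= normrM EFinM.
  by rewrite ge0_integralZl.
under eq_integral do rewrite E.
rewrite ge0_integralZr//; last exact: integral_ge0.
apply: lte_mul_pinfty; first exact: integral_ge0.
  rewrite ge0_fin_numE; last exact: integral_ge0.
  by have /integrableP[] := Xi.
by have /integrableP[] := Yi.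
Qed.

Lemma independent2_RintegralM (X Y : T -> R) : independent2 P X Y ->
  P.-integrable setT (EFin \o X) -> P.-integrable setT (EFin \o Y) ->
  \int[P]_t (X t * Y t) = (\int[P]_t X t) * (\int[P]_t Y t).
Proof.
move=> iXY Xi Yi.
have mX := integrable_EFin_measurable Xi.
have mY := integrable_EFin_measurable Yi.
have mh : measurable_fun setT (fun z : R * R => z.1 * z.2).
  exact: measurable_funM.
rewrite (Rintegral_independent2 mX mY iXY mh) /=; first last.
- by move=> x; exact: integrable_EFinZ.
- exact: independent2_integrableM.
under eq_Rintegral do rewrite RintegralZl//.
by rewrite RintegralZr.
Qed.

Lemma independent2_comp {d1 d2 e1 e2} {V1 : measurableType d1}
    {V2 : measurableType d2} {W1 : measurableType e1} {W2 : measurableType e2}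
    (X : T -> V1) (Y : T -> V2) (f : V1 -> W1) (g : V2 -> W2) :
  measurable_fun setT f -> measurable_fun setT g -> independent2 P X Y ->
  independent2 P (f \o X) (g \o Y).
Proof.
move=> mf mg iXY A B mA mB; apply: (iXY (f @^-1` A) (g @^-1` B)).
  by rewrite -[_ @^-1` _]setTI; exact: mf.
by rewrite -[_ @^-1` _]setTI; exact: mg.
Qed.

Section event.
Context {d1 d2} {V1 : measurableType d1} {V2 : measurableType d2}.

(** The conditional law of [(X, Y)] given [E] agrees on rectangles with the product of the marginal
    laws, hence everywhere, and that product is also the unconditional law. A null [E] is treated
    apart since conditioning divides by [P E]. *)
Lemma independent_event_pair (X : T -> V1) (Y : T -> V2) (E : set T) :
  measurable_fun setT X -> measurable_fun setT Y -> measurable E ->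
  independent2 P X Y ->
  (forall A B, measurable A -> measurable B ->
    P (X @^-1` A `&` (Y @^-1` B `&` E)) =
    (P E * (P (X @^-1` A) * P (Y @^-1` B)))%E) ->
  forall C, measurable C ->
  P ((fun t => (X t, Y t)) @^-1` C `&` E) =
  (P E * P ((fun t => (X t, Y t)) @^-1` C))%E.
Proof.
move=> mX mY mE iXY iE C mC.
have mXY := measurable_fun_pair mX mY.
have mpre : measurable ((fun t => (X t, Y t)) @^-1` C).
  by rewrite -[_ @^-1` _]setTI; exact: mXY.
have finE : P E \is a fin_num by exact: fin_num_measure.
have [E0|E0] := eqVneq (P E) 0%E.
  rewrite E0 mul0e; apply/eqP; rewrite eq_le measure_ge0 andbT -E0.
  by apply: le_measure; rewrite ?inE//; exact: measurableI.
pose X' := mfun_Sub (mem_set mX); pose Y' := mfun_Sub (mem_set mY).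
pose XY := mfun_Sub (mem_set mXY).
have law := @independent2_law _ _ _ _ _ _ _ P X' Y' XY erefl iXY.
have Egt0 : 0 < fine (P E).
  by rewrite fine_gt0// ltey_eq finE andbT lt0e E0 measure_ge0.
have k0 : 0 <= (fine (P E))^-1 by rewrite invr_ge0 ltW.
pose m0 : {measure set (V1 * V2) -> \bar R} :=
  mscale (NngNum k0) (pushforward (mrestr P mE) XY).
pose m' := m0 mXY.
have m'E D : m' D = ((fine (P E))^-1%:E * P (XY @^-1` D `&` E))%E by [].
have H : (distribution P X' \x distribution P Y')%E C = m' C.
  apply: product_measure_unique => // A B mA mB; rewrite m'E.
  rewrite (_ : _ `&` E = X @^-1` A `&` (Y @^-1` B `&` E)); last first.
    by apply/seteqP; split=> [t [[]]|t []] /= ? => [? ?|[]].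
  rewrite iE// muleA -[X in (_ * X * _)%E](fineK finE) -EFinM mulVf ?gt_eqF//.
  by rewrite mul1e.
move: H; rewrite [LHS]law// m'E => H.
rewrite -[X in _ = (_ * X)%E]/(distribution P XY C) H muleA.
by rewrite -[X in (X * _ * _)%E](fineK finE) -EFinM divff ?gt_eqF// mul1e.
Qed.

End event.

End independence_theory.

Section iid_sequences.
Context {d} {T : measurableType d} {R : realType} (P : probability T R).

Lemma mutually_independent_comp {d1 d2} {V1 : measurableType d1}
    {V2 : measurableType d2} (X : nat -> T -> V1) (g : V1 -> V2) :
  measurable_fun setT g -> mutually_independent P X ->
  mutually_independent P (fun i => g \o X i).
Proof.
move=> mg iX s B us mB.
apply: (iX s (fun i => g @^-1` B i)) => // i.
by rewrite -[_ @^-1` _]setTI; exact: mg.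
Qed.

Lemma identically_distributed_comp {d1 d2} {V1 : measurableType d1}
    {V2 : measurableType d2} (X : nat -> T -> V1) (g : V1 -> V2) :
  measurable_fun setT g -> identically_distributed P X ->
  identically_distributed P (fun i => g \o X i).
Proof.
move=> mg iX i B mB; apply: (iX i (g @^-1` B)).
by rewrite -[_ @^-1` _]setTI; exact: mg.
Qed.

Section identical.
Context {d1} {V : measurableType d1} (X : nat -> T -> V).
Hypothesis mX : forall i, measurable_fun setT (X i).
Hypothesis idX : identically_distributed P X.

Lemma identically_distributed_ge0_integral (g : V -> \bar R) i :
  measurable_fun setT g -> (forall v, 0 <= g v)%E ->
  (\int[P]_t g (X i t) = \int[P]_t g (X 0 t))%E.
Proof.
move=> mg g0; pose X' j := mfun_Sub (mem_set (mX j)).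
have E j := @ge0_integral_distribution _ _ _ _ _ P (X' j) g mg g0.
rewrite -[LHS](E i) -[RHS](E 0%N); apply: eq_measure_integral => A mA _.
exact: idX.
Qed.

Lemma identically_distributed_integrable (g : V -> R) i :
  measurable_fun setT g -> P.-integrable setT (EFin \o (fun t => g (X 0 t))) ->
  P.-integrable setT (EFin \o (fun t => g (X i t))).
Proof.
move=> mg /integrableP[_ gi]; apply/integrableP; split.
  by apply/measurable_EFinP; exact: measurableT_comp mg (mX i).
rewrite (@identically_distributed_ge0_integral (fun v => `|(g v)%:E|%E))//.
by apply: measurableT_comp => //; exact/measurable_EFinP.
Qed.

Lemma identically_distributed_Rintegral (g : V -> R) i :
  measurable_fun setT g -> P.-integrable setT (EFin \o (fun t => g (X 0 t))) ->
  \int[P]_t g (X i t) = \int[P]_t g (X 0 t).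
Proof.
move=> mg gi; pose X' j := mfun_Sub (mem_set (mX j)).
have mEg : measurable_fun setT (EFin \o g) by exact/measurable_EFinP.
have E j := @integral_distribution _ _ _ _ _ P (X' j) (EFin \o g) mEg
  (@identically_distributed_integrable g j mg gi).
rewrite /Rintegral; congr fine.
rewrite -[LHS](E i) -[RHS](E 0%N); apply: eq_measure_integral => A mA _.
exact: idX.
Qed.

End identical.

Section partial_sums.
Variable X : nat -> T -> R.
Hypothesis mX : forall i, measurable_fun setT (X i).
Hypothesis iX : mutually_independent P X.

Let S n t := \sum_(i < n) X i t.

Lemma measurable_partial_sum n : measurable_fun setT (S n).
Proof. by apply: measurable_sum => i. Qed.

Let event (s : seq nat) (B : nat -> set R) :=
  \big[setI/setT]_(i <- s) (X i @^-1` B i).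

Let measurable_event s B : (forall i, measurable (B i)) -> measurable (event s B).
Proof.
move=> mB; apply: big_ind => //; first exact: measurableI.
by move=> i _; rewrite -[_ @^-1` _]setTI; exact: mX.
Qed.

(** Independence from the next term alone is not inductive: splitting off [X n] leaves an event
    about later terms to carry along. The claim therefore covers every finite list of indices that
    are at least [n]. *)
Let partial_sum_event n s B A : uniq s -> all (leq n) s ->
  (forall i, measurable (B i)) -> measurable A ->
  P (S n @^-1` A `&` event s B) = (P (event s B) * P (S n @^-1` A))%E.
Proof.
elim: n s B A => [|n IH] s B A us ns mB mA.
  have -> : S 0%N = cst 0 by apply/funext => t; rewrite /S big_ord0.
  rewrite preimage_cst; case: ifPn => _.
    by rewrite setTI probability_setT mule1.
  by rewrite set0I measure0 mule0.
have ns' : n \notin s by apply/negP => /(allP ns); rewrite ltnn.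
(* [B'] overrides [B] at index [n], so that the condition on [X n] and the event on [s] form a
   single event on [n :: s]; since [n] is not in [s], nothing else changes. *)
pose B' (C : set R) i := if i == n then C else B i.
have mB' C : measurable C -> forall i, measurable (B' C i).
  by move=> mC i; rewrite /B'; case: ifPn.
have EB' C : event (n :: s) (B' C) = X n @^-1` C `&` event s B.
  rewrite /event big_cons {1}/B' eqxx; congr (_ `&` _).
  apply: eq_big_seq => i si; rewrite /B' ifN//.
  by apply: contraNneq ns' => <-.
have us' : uniq (n :: s) by rewrite /= ns'.
have an : all (leq n) (n :: s).
  by rewrite /= leqnn; apply: sub_all ns => i; exact: ltnW.
have PE s' C : uniq s' -> (forall i, measurable (C i)) ->
    P (event s' C) = (\prod_(i <- s') fine (P (X i @^-1` C i)))%:E.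
  by move=> *; rewrite iX.
have mpX C : measurable C -> measurable (X n @^-1` C).
  by move=> mC; rewrite -[_ @^-1` _]setTI; exact: mX.
have PEB' C : measurable C ->
    P (X n @^-1` C `&` event s B) = (P (event s B) * P (X n @^-1` C))%E.
  move=> mC; rewrite -EB' PE//; last exact: mB'.
  rewrite big_cons {1}/B' eqxx PE// muleC EFinM fineK; last exact/fin_num_measure/mpX.
  congr (_ * (_)%:E)%E.
  apply: eq_big_seq => i si; rewrite /B' ifN//.
  by apply: contraNneq ns' => <-.
have iSX : independent2 P (S n) (X n).
  move=> A' C mA' mC; have := @IH [:: n] (fun=> C) A' erefl _ (fun=> mC) mA'.
  rewrite /event big_seq1 => -> //=; last by rewrite leqnn.
  rewrite muleC EFinM !fineK//; apply: fin_num_measure; first exact: mpX.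
  by rewrite -[_ @^-1` _]setTI; exact: measurable_partial_sum.
have mA2 : measurable ((fun z : R * R => z.1 + z.2) @^-1` A).
  by rewrite -[_ @^-1` _]setTI; apply: measurable_funD.
have -> : S n.+1 @^-1` A = (fun t => (S n t, X n t)) @^-1` ((fun z : R * R =>
  z.1 + z.2) @^-1` A).
  by apply/seteqP; split => t /=; rewrite /S big_ord_recr.
apply: independent_event_pair => //.
- exact: measurable_partial_sum.
- exact: measurable_event.
- move=> A' C mA' mC; rewrite -EB' IH//; last exact: mB'.
  by rewrite EB' PEB'// -muleA (muleC (P (X n @^-1` C))).
Qed.

Lemma independent2_partial_sum n : independent2 P (S n) (X n).
Proof.
move=> A C mA mC.
have := @partial_sum_event n [:: n] (fun=> C) A erefl _ (fun=> mC) mA.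
rewrite /event big_seq1 => -> //=; last by rewrite leqnn.
rewrite muleC EFinM !fineK//; apply: fin_num_measure.
  by rewrite -[_ @^-1` _]setTI; exact: mX.
by rewrite -[_ @^-1` _]setTI; exact: measurable_partial_sum.
Qed.

End partial_sums.

End iid_sequences.

(** * Second moments and stochastic orders *)

Section second_moments.
Context {d} {T : measurableType d} {R : realType} (P : probability T R).

Lemma integrable_sqr_mul (X Y : T -> R) :
  measurable_fun setT X -> measurable_fun setT Y ->
  P.-integrable setT (EFin \o (fun t => X t ^+ 2)) ->
  P.-integrable setT (EFin \o (fun t => Y t ^+ 2)) ->
  P.-integrable setT (EFin \o (fun t => X t * Y t)).
Proof.
move=> mX mY X2 Y2; apply: le_integrable_EFin (integrable_EFinD X2 Y2).
  exact: measurable_funM.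
move=> t; rewrite ler_norml.
by have := sqr_ge0 (X t + Y t); have := sqr_ge0 (X t - Y t); nra.
Qed.

Lemma integrable_sqr (X : T -> R) : measurable_fun setT X ->
  P.-integrable setT (EFin \o (fun t => X t ^+ 2)) ->
  P.-integrable setT (EFin \o X).
Proof.
move=> mX X2.
apply: eq_integrable (integrable_sqr_mul (Y := fun=> 1) mX _ X2 _) => //.
  by move=> t _; rewrite /= mulr1.
by apply: (@bounded_integrable _ _ _ P _ 1) => // t; rewrite expr1n normr1.
Qed.

(** Markov's inequality for [X ^+ 2], packaged as an exceptional event in the shape that [op1] and
    [Op1] use. *)
Lemma chebyshev_event (X : T -> R) (K : R) : measurable_fun setT X -> 0 < K ->
  P.-integrable setT (EFin \o (fun t => X t ^+ 2)) ->
  exists A, [/\ measurable A, (P A <= ((\int[P]_t X t ^+ 2) / K ^+ 2)%:E)%E &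
    forall t, ~ A t -> `|X t| <= K].
Proof.
move=> mX K0 X2; exists [set t | K < `|X t|].
have mA : measurable [set t | K < `|X t|].
  rewrite (_ : [set _ | _] = (fun t => `|X t|) @^-1` `]K, +oo[%classic).
    by rewrite -[_ @^-1` _]setTI; apply: measurableT_comp.
  by apply/seteqP; split => t /=; rewrite in_itv/= andbT.
split => //; last by move=> t /=; rewrite leNgt => /negP.
rewrite -[leLHS]fineK; last exact: fin_num_measure.
rewrite lee_fin ler_pdivlMr ?exprn_gt0// mulrC -Rintegral_indic//.
rewrite -RintegralZl//; last exact: integrable_indic.
apply: le_Rintegral => //.
  exact/integrable_EFinZ/integrable_indic.
move=> t _; rewrite indicE; case: (boolP (t \in _)) => [|_]; last first.
  by rewrite mulr0 sqr_ge0.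
rewrite inE/= mulr1 => Kt; rewrite -(real_normK (num_real (X t))).
by rewrite ler_sqr ?nnegrE// ltW.
Qed.

Section partial_sum_moments.
Variable X : nat -> T -> R.
Hypothesis mX : forall i, measurable_fun setT (X i).
Hypothesis iX : mutually_independent P X.
Hypothesis idX : identically_distributed P X.
Hypothesis X2 : P.-integrable setT (EFin \o (fun t => X 0 t ^+ 2)).
Hypothesis EX : \int[P]_t X 0 t = 0.

Let X2i i : P.-integrable setT (EFin \o (fun t => X i t ^+ 2)).
Proof. exact: (identically_distributed_integrable mX idX (g := fun x => x ^+ 2)). Qed.

Let Xi i : P.-integrable setT (EFin \o X i).
Proof. exact: integrable_sqr. Qed.

(** The cross term integrates to zero because [X n] is centred and independent of the preceding
    partial sum, so each term adds the same variance. *)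
Lemma partial_sum_sqr n :
  P.-integrable setT (EFin \o (fun t => (\sum_(i < n) X i t) ^+ 2)) /\
  \int[P]_t (\sum_(i < n) X i t) ^+ 2 = n%:R * \int[P]_t X 0 t ^+ 2.
Proof.
elim: n => [|n [IHi IH]].
  split.
    by apply: eq_integrable (integrable0 _ _) => // t _; rewrite /= big_ord0 expr0n.
  under eq_Rintegral do rewrite big_ord0 expr0n.
  by rewrite Rintegral_prob_cst mul0r.
have Si : P.-integrable setT (EFin \o (fun t => \sum_(i < n) X i t)).
  apply: eq_integrable (integrable_EFin_sum (index_enum 'I_n)
    (fun i => Xi (nat_of_ord i))) => //.
have iS := independent2_partial_sum mX iX n.
have SXi := independent2_integrableM iS Si (Xi n).
have E t : (\sum_(i < n.+1) X i t) ^+ 2 = (\sum_(i < n) X i t) ^+ 2 +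
    (2 * ((\sum_(i < n) X i t) * X n t) + X n t ^+ 2).
  by rewrite big_ord_recr/=; ring.
have i2 := integrable_EFinD (integrable_EFinZ 2 SXi) (X2i n).
split.
  by apply: eq_integrable (integrable_EFinD IHi i2) => // t _; rewrite /= E.
under eq_Rintegral do rewrite E.
rewrite RintegralD// IH RintegralD//; last exact: integrable_EFinZ.
rewrite RintegralZl// independent2_RintegralM//.
have -> : \int[P]_t X n t = 0.
  rewrite -EX; apply: (identically_distributed_Rintegral mX idX (g := id)) => //.
have -> : \int[P]_t X n t ^+ 2 = \int[P]_t X 0 t ^+ 2.
  exact: (identically_distributed_Rintegral mX idX (g := fun x => x ^+ 2)).
by rewrite mulr0 mulr0 add0r -natr1 mulrDl mul1r.
Qed.

End partial_sum_moments.

End second_moments.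

(** * Calculus of o_P(1) and O_P(1) *)

Section stochastic_order.
Context {d} {T : measurableType d} {R : realType} (P : probability T R).
Implicit Types X Y : nat -> T -> R.

(* Convergence to 0 in probability and tightness are phrased with an
   exceptional event rather than with P(|X_n| > e), so that no measurability
   of X_n is needed. *)
Definition op1 X := forall e : R, 0 < e -> \forall n \near \oo,
  exists A, [/\ measurable A, (P A <= e%:E)%E & forall t, ~ A t -> `|X n t| <= e].

Definition Op1 X := forall e : R, 0 < e -> exists2 K : R, 0 < K &
  \forall n \near \oo,
  exists A, [/\ measurable A, (P A <= e%:E)%E & forall t, ~ A t -> `|X n t| <= K].

Lemma op1_Op1 X : op1 X -> Op1 X.
Proof. by move=> oX e e0; exists e => //; exact: oX. Qed.

Let event_union (A B : set T) (a b : R) : measurable A -> measurable B ->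
  (P A <= a%:E)%E -> (P B <= b%:E)%E -> (P (A `|` B) <= (a + b)%:E)%E.
Proof.
move=> mA mB PA PB; apply: le_trans (measureU2 P mA mB) _.
by rewrite EFinD leeD.
Qed.

Lemma Op1D X Y : Op1 X -> Op1 Y -> Op1 (fun n t => X n t + Y n t).
Proof.
move=> oX oY e e0; have e20 : 0 < e / 2 by rewrite divr_gt0.
have [K K0 hX] := oX _ e20; have [L L0 hY] := oY _ e20.
exists (K + L); first exact: addr_gt0.
near=> n.
have [A [mA PA AX]] : exists A, [/\ measurable A, (P A <= (e / 2)%:E)%E &
  forall t, ~ A t -> `|X n t| <= K] by near: n.
have [B [mB PB BY]] : exists A, [/\ measurable A, (P A <= (e / 2)%:E)%E &
  forall t, ~ A t -> `|Y n t| <= L] by near: n.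
exists (A `|` B); split; first exact: measurableU.
  by rewrite [e]splitr; exact: event_union.
move=> t /not_orP[nA nB]; apply: le_trans (ler_normD _ _) _.
by apply: lerD; [exact: AX|exact: BY].
Unshelve. all: by end_near. Qed.

Lemma op1D X Y : op1 X -> op1 Y -> op1 (fun n t => X n t + Y n t).
Proof.
move=> oX oY e e0; have e20 : 0 < e / 2 by rewrite divr_gt0.
have hX := oX _ e20; have hY := oY _ e20.
near=> n.
have [A [mA PA AX]] : exists A, [/\ measurable A, (P A <= (e / 2)%:E)%E &
  forall t, ~ A t -> `|X n t| <= e / 2] by near: n.
have [B [mB PB BY]] : exists A, [/\ measurable A, (P A <= (e / 2)%:E)%E &
  forall t, ~ A t -> `|Y n t| <= e / 2] by near: n.
exists (A `|` B); split; first exact: measurableU.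
  by rewrite [e]splitr; exact: event_union.
move=> t /not_orP[nA nB]; rewrite [e]splitr.
apply: le_trans (ler_normD _ _) _.
by apply: lerD; [exact: AX|exact: BY].
Unshelve. all: by end_near. Qed.

Lemma Op1M_op1 X Y : Op1 X -> op1 Y -> op1 (fun n t => X n t * Y n t).
Proof.
move=> oX oY e e0; have e20 : 0 < e / 2 by rewrite divr_gt0.
have [K K0 hX] := oX _ e20.
(* One level serves twice: [e / 2] bounds the exceptional probability, and [e / K] brings the
   product down to [K * (e / K) = e]. *)
have f0 : 0 < Num.min (e / 2) (e / K) by rewrite lt_min e20 divr_gt0.
have hY := oY _ f0.
near=> n.
have [A [mA PA AX]] : exists A, [/\ measurable A, (P A <= (e / 2)%:E)%E &
  forall t, ~ A t -> `|X n t| <= K] by near: n.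
have [B [mB PB BY]] : exists A, [/\ measurable A,
  (P A <= (Num.min (e / 2) (e / K))%:E)%E &
  forall t, ~ A t -> `|Y n t| <= Num.min (e / 2) (e / K)] by near: n.
exists (A `|` B); split; first exact: measurableU.
  rewrite [e]splitr; apply: event_union => //.
  by apply: le_trans PB _; rewrite lee_fin ge_min lexx.
move=> t /not_orP[nA nB]; rewrite normrM.
apply: (@le_trans _ _ (K * (e / K))); last by rewrite mulrCA divff ?gt_eqF// mulr1.
apply: ler_pM => //; first exact: AX.
by apply: le_trans (BY _ nB) _; rewrite ge_min lexx orbT.
Unshelve. all: by end_near. Qed.

Lemma op1_cst (u : nat -> R) : u n @[n --> \oo] --> 0 -> op1 (fun n _ => u n).
Proof.
move=> /cvgr0Pnorm_le u0 e e0; near=> n.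
by exists set0; split => //; [rewrite measure0 lee_fin ltW|move=> t _; near: n;
  exact: u0].
Unshelve. all: by end_near. Qed.

Lemma Op1_cst (c : R) : Op1 (fun _ _ => c).
Proof.
move=> e e0; exists (`|c| + 1); first by rewrite ltr_wpDl.
by near=> n; exists set0; split => //; [rewrite measure0 lee_fin ltW|move=> t _;
  rewrite lerDl].
Unshelve. all: by end_near. Qed.

Lemma op1Z (c : R) X : op1 X -> op1 (fun n t => c * X n t).
Proof. exact: Op1M_op1 (@Op1_cst c). Qed.

Lemma cvg_inv_sqrt_nat : (Num.sqrt (n%:R : R))^-1 @[n --> \oo] --> 0.
Proof.
apply/cvgr0Pnorm_le => e e0; near=> n.
have n0 : 0 < (n%:R : R) by near: n; exact: nbhs_infty_gtr.
rewrite ger0_norm ?invr_ge0 ?sqrtr_ge0//.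
rewrite -[leRHS]invrK lef_pV2 ?posrE ?invr_gt0 ?sqrtr_gt0//.
have -> : e^-1 = Num.sqrt (e^-1 ^+ 2) by rewrite sqrtr_sqr gtr0_norm ?invr_gt0.
by rewrite ler_sqrt ?ler0n//; near: n; exact: nbhs_infty_ger.
Unshelve. all: by end_near. Qed.

Lemma Op1_scaled_sum (X : nat -> T -> R) :
  (forall i, measurable_fun setT (X i)) -> mutually_independent P X ->
  identically_distributed P X ->
  P.-integrable setT (EFin \o (fun t => X 0 t ^+ 2)) ->
  \int[P]_t X 0 t = 0 ->
  Op1 (fun n t => (\sum_(i < n) X i t) / Num.sqrt n%:R).
Proof.
move=> mX iX idX X2 EX e e0.
set v := \int[P]_t X 0 t ^+ 2.
have v0 : 0 <= v by apply: Rintegral_ge0 => t _; exact: sqr_ge0.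
(* Chebyshev asks for [v / K ^+ 2 <= e]. With [K = 1 + v / e], which is at least 1, [K ^+ 2]
   dominates [v / e]; the 1 keeps [K] positive when [v = 0]. *)
have K0 : 0 < 1 + v / e by rewrite ltr_pwDl// divr_ge0// ltW.
exists (1 + v / e) => //; near=> n.
have n0 : 0 < (n%:R : R) by near: n; exact: nbhs_infty_gtr.
have [Si SE] := partial_sum_sqr mX iX idX X2 EX n.
have mS : measurable_fun setT (fun t => (\sum_(i < n) X i t) / Num.sqrt n%:R).
  by apply: measurable_funM => //; exact: measurable_partial_sum.
have E t : ((\sum_(i < n) X i t) / Num.sqrt n%:R) ^+ 2 =
    n%:R^-1 * (\sum_(i < n) X i t) ^+ 2.
  by rewrite exprMn exprVn sqr_sqrtr ?ler0n// mulrC.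
have Si2 : P.-integrable setT
    (EFin \o (fun t => ((\sum_(i < n) X i t) / Num.sqrt n%:R) ^+ 2)).
  apply: eq_integrable (integrable_EFinZ n%:R^-1 Si) => // t _.
  by rewrite /= E.
have [A [mA PA AX]] := chebyshev_event mS K0 Si2.
exists A; split => //; apply: le_trans PA _; rewrite lee_fin.
rewrite (@eq_Rintegral _ _ _ P setT (fun t =>
  n%:R^-1 * (\sum_(i < n) X i t) ^+ 2)); last by move=> t _; exact: E.
rewrite RintegralZl// SE mulrA mulVf ?gt_eqF// mul1r -/v.
rewrite ler_pdivrMr ?exprn_gt0//.
have ve : v = e * (v / e) by rewrite mulrCA divff ?gt_eqF// mulr1.
have w0 : 0 <= v / e by rewrite divr_ge0// ltW.
by rewrite {1}ve ler_pM2l//; nra.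
Unshelve. all: by end_near. Qed.

Lemma op1_sample_mean (X : nat -> T -> R) :
  (forall i, measurable_fun setT (X i)) -> mutually_independent P X ->
  identically_distributed P X ->
  P.-integrable setT (EFin \o (fun t => X 0 t ^+ 2)) ->
  \int[P]_t X 0 t = 0 ->
  op1 (fun n => smean n X).
Proof.
move=> mX iX idX X2 EX.
have := Op1M_op1 (Op1_scaled_sum mX iX idX X2 EX) (op1_cst cvg_inv_sqrt_nat).
move=> h e e0; apply: filterS (h e e0) => n [A [mA PA AX]].
exists A; split => // t /AX; rewrite /smean -mulrA -invfM -expr2 sqr_sqrtr//.
Qed.

End stochastic_order.

(** * The standard Gaussian law *)

Section lebesgue_affine.
Context {R : realType}.
Notation mu := (@lebesgue_measure R).

Lemma ge0_integral_affine (h : R -> R) (a b : R) : 0 < a -> continuous h ->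
  (forall x, 0 <= h x) ->
  (\int[mu]_x (h x)%:E = \int[mu]_x (h (a * x + b) * a)%:E)%E.
Proof.
(* Written as a shift followed by a scaling, the affine map has immediate limits at both
   infinities. *)
move=> a0 ch h0; pose F (x : R^o) : R^o := (x + b / a) * a.
have FE x : F x = a * x + b by rewrite /F mulrDl divfK ?gt_eqF// mulrC.
have F'E : F^`()%classic = cst a.
  apply/funext => x; rewrite /F derive1E deriveM// deriveD// !derive_cst derive_id.
  by rewrite scaler0 add0r addr0 /GRing.scale/= mulr1.
rewrite (@increasing_ge0_integration_by_substitutionT _ F h)//.
- by apply: eq_integral => x _; rewrite F'E -FE.
- by move=> x y xy; rewrite /F ltr_pM2r// ltrD2r.
- by rewrite F'E => x; exact: cvg_cst.
- by rewrite F'E; exact: is_cvg_cst.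
- by rewrite F'E; exact: is_cvg_cst.
- by apply/gt0_cvgMlNy => //; exact: cvg_addrr_Ny.
- by apply/gt0_cvgMly => //; exact: cvg_addrr.
Qed.

End lebesgue_affine.

Section standard_gaussian.
Context {R : realType}.
Notation mu := (@lebesgue_measure R).
Local Notation phi := (@normal_pdf R 0 1).
Local Notation gamma := (@normal_prob R 0 1).

(** The Radon-Nikodym derivative of [gamma] is almost everywhere [phi], since both integrate to
    [gamma A] over every measurable [A]. *)
Lemma ge0_integral_normal_prob (f : R -> \bar R) : measurable_fun setT f ->
  (forall x, 0 <= f x)%E ->
  (\int[gamma]_x f x = \int[mu]_x (f x * (phi x)%:E))%E.
Proof.
move=> mf f0.
have dom : gamma `<< mu by exact: normal_prob_dominates.
rewrite -(Radon_Nikodym_SigmaFinite.change_of_variables dom f0 measurableT mf).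
apply: ae_eq_integral => //.
- apply: emeasurable_funM => //.
  exact: measurable_int (Radon_Nikodym_SigmaFinite.f_integrable dom).
- apply: emeasurable_funM => //; apply/measurable_EFinP.
  exact: measurable_normal_pdf.
apply: ae_eqe_mul2l.
apply: integral_ae_eq => //.
- exact: Radon_Nikodym_SigmaFinite.f_integrable.
- by apply/measurable_EFinP; exact: measurable_normal_pdf.
- by move=> A _ mA; rewrite -Radon_Nikodym_SigmaFinite.f_integral.
Qed.

Lemma normal_pdf01E x : phi x = normal_peak 1 * expR (- (x ^+ 2 / 2)).
Proof.
by rewrite /normal_pdf (negbTE (oner_neq0 R)) /normal_fun subr0 expr1n mulNr.
Qed.

Lemma continuous_phi : continuous phi.
Proof. exact/continuous_normal_pdf/oner_neq0. Qed.

(** With [z = (c u - a y) / b], that is [a y + b z = c u], the sum [y^2 + z^2] equals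
    [(c^2 u^2 - 2 a c u y + c^2 y^2) / b^2], which is symmetric in [y] and [u]. *)
Lemma phi_rotation (a b c y u : R) : b != 0 -> c ^+ 2 = a ^+ 2 + b ^+ 2 ->
  phi y * phi (c / b * u + - (a * y / b)) = phi u * phi (c / b * y + - (a * u / b)).
Proof.
move=> b0 cab; rewrite !normal_pdf01E.
rewrite [LHS]mulrACA [RHS]mulrACA -!expRD; congr (_ * expR _).
have -> : c / b * u + - (a * y / b) = (c * u - a * y) / b by field.
have -> : c / b * y + - (a * u / b) = (c * y - a * u) / b by field.
rewrite !exprMn exprVn.
have -> : (c * u - a * y) ^+ 2 =
  c ^+ 2 * u ^+ 2 - 2 * c * u * a * y + a ^+ 2 * y ^+ 2 by ring.
have -> : (c * y - a * u) ^+ 2 =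
  c ^+ 2 * y ^+ 2 - 2 * c * u * a * y + a ^+ 2 * u ^+ 2 by ring.
by rewrite cab; field.
Qed.

(** Instead of rotating the plane, [a y + b z = c u] is substituted in the inner variable alone
    (Jacobian [c / b]) and the integrals are exchanged. By [phi_rotation] the factor left to
    integrate in [y] is [phi] after an affine substitution, of mass 1. *)
Lemma ge0_gaussian_stable (f : R -> R) (a b c : R) : 0 < b -> 0 < c ->
  c ^+ 2 = a ^+ 2 + b ^+ 2 -> continuous f -> (forall x, 0 <= f x) ->
  (\int[gamma]_y \int[gamma]_z (f (a * y + b * z))%:E =
   \int[gamma]_y (f (c * y))%:E)%E.
Proof.
move=> b0 c0 cab cf f0.
have bn0 : b != 0 by rewrite gt_eqF.
have phi0 x : 0 <= phi x by exact: normal_pdf_ge0.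
have mphi : measurable_fun setT phi by exact: measurable_normal_pdf.
have mf : measurable_fun setT f by exact: continuous_measurable_fun.
have mfz : measurable_fun setT (fun w : R * R => (f (a * w.1 + b * w.2))%:E).
  apply/measurable_EFinP; apply: measurableT_comp => //.
  by apply: measurable_funD; apply: measurable_funM.
pose g (y u : R) := f (c * u) * (phi y * phi (c / b * u + - (a * y / b)) * (c / b)).
have mg : measurable_fun setT (fun w : R * R => (g w.1 w.2)%:E).
  apply/measurable_EFinP; apply: measurable_funM.
    by apply: measurableT_comp => //; apply: measurable_funM.
  apply: measurable_funM => //; apply: measurable_funM.
    exact: measurableT_comp.
  apply: measurableT_comp => //; apply: measurable_funD.
    exact: measurable_funM.
  by apply: measurableT_comp => //; apply: measurable_funM => //;
    apply: measurable_funM.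
have cb0 : 0 < c / b by rewrite divr_gt0.
have g0 y u : 0 <= g y u by apply: mulr_ge0 => //; apply: mulr_ge0;
  [exact: mulr_ge0|exact: ltW].
rewrite ge0_integral_normal_prob; first last.
- by move=> y; apply: integral_ge0 => z _; rewrite lee_fin.
- apply: (measurable_fun_fubini_tonelli_F (m2 :=
  gamma) (fun w : R * R => (f (a * w.1 + b * w.2))%:E)) => // w.
  by rewrite lee_fin.
transitivity (\int[mu]_y \int[mu]_u (g y u)%:E)%E.
  apply: eq_integral => y _.
  rewrite ge0_integral_normal_prob; first last.
  - by move=> z; rewrite lee_fin.
  - exact: measurableT_comp mfz (pair1_measurable y).
  rewrite -ge0_integralZr//; first last.
  - by rewrite lee_fin.
  - by move=> z _; rewrite mule_ge0// lee_fin.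
  - apply: emeasurable_funM; last exact/measurable_EFinP.
    exact: measurableT_comp mfz (pair1_measurable y).
  under eq_integral do rewrite -!EFinM.
  rewrite (@ge0_integral_affine _ _ (c / b) (- (a * y / b)) cb0); first last.
  - by move=> z; rewrite !mulr_ge0.
  - move=> z; apply: cvgM; last exact: cvg_cst.
    apply: cvgM; last exact: continuous_phi.
    apply: (@continuous_comp _ _ _ (fun x => a * y + b * x) f); last exact: cf.
    apply: cvgD; first exact: cvg_cst.
    by apply: cvgM; [exact: cvg_cst|exact: cvg_id].
  apply: eq_integral => u _; congr EFin; rewrite /g.
  have -> : a * y + b * (c / b * u + - (a * y / b)) = c * u by field.
  by ring.
rewrite (fubini_tonelli (m1 := mu) (m2 := mu) (fun w : R * R => (g w.1 w.2)%:E))//;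
  last first.
  by move=> w; rewrite lee_fin.
rewrite ge0_integral_normal_prob; first last.
- by move=> y; rewrite lee_fin.
- by apply/measurable_EFinP; apply: measurableT_comp => //; exact: measurable_funM.
apply: eq_integral => u _ /=; rewrite /g.
under eq_integral do rewrite phi_rotation// -(mulrA (phi u)) (mulrA (f _)) EFinM.
rewrite ge0_integralZl//.
- rewrite -(@ge0_integral_affine _ phi)//; last exact: continuous_phi.
  by rewrite integral_normal_pdf mule1 EFinM.
- apply/measurable_EFinP/measurable_funM => //; apply: measurableT_comp => //.
  by apply: measurable_funD => //; exact: measurable_funM.
- by move=> y _; rewrite lee_fin mulr_ge0// ltW.
- by rewrite lee_fin mulr_ge0.
Qed.

End standard_gaussian.

(** * Mean and variance of the standard Gaussian *)

Section gaussian_moments.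
Context {R : realType}.
Notation mu := (@lebesgue_measure R).
Local Notation phi := (@normal_pdf R 0 1).
Local Notation gamma := (@normal_prob R 0 1).

Let phi0 x : 0 <= phi x. Proof. exact: normal_pdf_ge0. Qed.

Let mphi : measurable_fun setT phi. Proof. exact: measurable_normal_pdf. Qed.

Let phiN x : phi (- x) = phi x. Proof. by rewrite !normal_pdf01E sqrrN. Qed.

Lemma is_derive_phi (x : R) : is_derive x 1 phi (- x * phi x).
Proof.
have -> : phi = (fun x => normal_peak 1 * expR (- (x ^+ 2 / 2))).
  by apply/funext => y; exact: normal_pdf01E.
have d1 : is_derive x 1 (fun x : R => - (x ^+ 2 / 2)) (- x).
  by apply: is_derive_eq; rewrite /GRing.scale/=; field.
have d2 := @is_derive1_comp _ expR (fun x : R =>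
  - (x ^+ 2 / 2)) x _ _ (is_derive_expR _) d1.
apply: is_derive_eq; rewrite /GRing.scale/=; ring.
Qed.

Let xphi_cvg0 : (- x * phi x) @[x --> +oo] --> 0.
Proof.
apply/cvgr0Pnorm_le => e e0; near=> x.
have x0 : 0 < x by near: x; exact: nbhs_pinfty_gt.
have k0 : 0 <= normal_peak (1 : R) by exact: normal_peak_ge0.
rewrite normrM normrN (gtr0_norm x0) (ger0_norm (phi0 x)) normal_pdf01E.
rewrite expRN mulrCA.
(* [expR (x ^+ 2 / 2) >= 1 + x ^+ 2 / 2] bounds [x * expR (- (x ^+ 2 / 2))] by [2 / x]. *)
apply: (@le_trans _ _ (normal_peak 1 * (2 / x))).
  rewrite ler_wpM2l// ler_pdivlMr// -mulrA mulrCA ler_pdivrMl ?expR_gt0//.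
  have := expR_ge1Dx (x ^+ 2 / 2); rewrite expr2.
  by set E := expR _; lra.
rewrite mulrA ler_pdivrMr// mulrC -ler_pdivrMl//; near: x.
Unshelve. all: by end_near. Qed.

Let cphi := @continuous_phi R.

Let csq : continuous (fun x : R => x ^+ 2 * phi x).
Proof. by move=> x; apply: cvgM; [exact: sqr_continuous|exact: cphi]. Qed.

(** The derivative of [x * phi x] is [phi x - x ^+ 2 * phi x], which on the positive half-line
    changes sign at 1. Cutting there keeps all integrands nonnegative, so the comparison with the
    mass of [phi] runs in the extended reals without prior integrability. The two boundary terms
    [phi 1] balance each other. *)
Lemma ge0_gaussian_second_moment : (\int[gamma]_x (x ^+ 2)%:E = 1)%E.
Proof.
rewrite ge0_integral_normal_prob; first last.
- by move=> x; rewrite lee_fin sqr_ge0.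
- by apply/measurable_EFinP; exact: exprn_measurable.
under eq_integral do rewrite -EFinM.
have msq : measurable_fun setT (fun x : R => x ^+ 2 * phi x).
  exact: continuous_measurable_fun.
have sq0 x : 0 <= x ^+ 2 * phi x by rewrite mulr_ge0// sqr_ge0.
have half (h : R -> R) : continuous h -> (forall x, 0 <= h x) ->
    (\int[mu]_(x in [set x | (0 <= x)%R]) (h x)%:E =
     \int[mu]_(x in `[0%R, 1%R]) (h x)%:E + \int[mu]_(x in `[1%R, +oo[) (h x)%:E)%E.
  move=> ch h0; have mh : measurable_fun setT h by exact: continuous_measurable_fun.
  rewrite -[X in (_ + X)%E]integral_itv_obnd_cbnd;
    last exact/measurable_funTS/measurable_EFinP.
  rewrite -ge0_integral_setU//=.
  - congr (integral _ _ _); apply/seteqP; split => [x /= x0|x [] /=].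
    + by case: (leP x 1) => x1; [left|right]; rewrite /= in_itv/= ?x0 ?x1.
    + by rewrite in_itv/= => /andP[].
    + by rewrite in_itv/= andbT => /ltW; exact: le_trans.
  - exact/measurable_funTS/measurable_EFinP.
  - by move=> x _; rewrite lee_fin.
  - rewrite disj_set2E; apply/eqP; rewrite -subset0 => x [] /=;
    rewrite !in_itv/= andbT.
    by move=> /andP[_]; rewrite leNgt => /negP.
rewrite ge0_symfun_integralT//; last by move=> x /=; rewrite sqrrN phiN.
have <- := integral_normal_pdf (0 : R) 1.
rewrite ge0_symfun_integralT//; last by move=> x /=; rewrite phiN.
congr (_ * _)%E; rewrite !half//.
have dF (x : R) : is_derive x 1 (fun x => x * phi x) (phi x - x ^+ 2 * phi x).
  have dp := is_derive_phi x.
  by apply: is_derive_eq; rewrite /GRing.scale/=; ring.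
have cF : continuous (fun x : R => x * phi x).
  by move=> x; apply: cvgM; [exact: cvg_id|exact: cphi].
have cdiff : continuous (fun x : R => phi x - x ^+ 2 * phi x).
  by move=> x; apply: cvgB; [exact: cphi|exact: csq].
have E1 : (\int[mu]_(x in `[0%R, 1%R]) (phi x - x ^+ 2 * phi x)%:E = (phi 1)%:E)%E.
  rewrite (@continuous_FTC2 _ _ (fun x => x * phi x))//.
  - by rewrite mul0r mul1r sube0.
  - exact: continuous_subspaceT.
  - split => //; first exact: cvg_at_right_filter (cF _).
    exact: cvg_at_left_filter (cF _).
  - by move=> x _; rewrite derive1E; apply: derive_val.
have E2 : (\int[mu]_(x in `[1%R, +oo[) (x ^+ 2 * phi x - phi x)%:E = (phi 1)%:E)%E.
  have dNF (x : R) : is_derive x 1 (fun x => - x * phi x) (x ^+ 2 * phi x - phi x).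
    have dp := is_derive_phi x.
    by apply: is_derive_eq; rewrite /GRing.scale/=; ring.
  have cNF : continuous (fun x : R => - x * phi x).
    by move=> x; apply: cvgM; [apply: cvgN; exact: cvg_id|exact: cphi].
  rewrite (@ge0_continuous_FTC2y _ _ (fun x => - x * phi x) _ 0)//.
  - by rewrite sub0e mulN1r EFinN oppeK.
  - move=> x x1; rewrite subr_ge0 ler_peMl// -(expr1n _ 2) ler_sqr ?nnegrE//.
    exact: le_trans x1.
  - apply: continuous_subspaceT => x.
    by apply: cvgB; [exact: csq|exact: cphi].
  - exact: cvg_at_right_filter (cNF _).
  - by move=> x _; rewrite derive1E; apply: derive_val.
have -> : (\int[mu]_(x in `[0%R, 1%R]) (phi x)%:E =
    \int[mu]_(x in `[0%R, 1%R]) (x ^+ 2 * phi x)%:E + (phi 1)%:E)%E.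
  rewrite -E1 -ge0_integralD//=.
  - by apply: eq_integral => x _; rewrite -EFinD addrC subrK.
  - by move=> x _; rewrite lee_fin.
  - exact/measurable_funTS/measurable_EFinP.
  - move=> x; rewrite in_itv/= => /andP[x0 x1]; rewrite lee_fin subr_ge0.
    by rewrite ler_piMl// exprn_ile1.
  - by apply/measurable_funTS/measurable_EFinP;
    exact: continuous_measurable_fun cdiff.
have -> : (\int[mu]_(x in `[1%R, +oo[) (x ^+ 2 * phi x)%:E =
    \int[mu]_(x in `[1%R, +oo[) (phi x)%:E + (phi 1)%:E)%E.
  rewrite -E2 -ge0_integralD//=.
  - by apply: eq_integral => x _; rewrite -EFinD addrC subrK.
  - by move=> x _; rewrite lee_fin.
  - exact/measurable_funTS/measurable_EFinP.
  - move=> x; rewrite in_itv/= andbT => x1; rewrite lee_fin subr_ge0.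
    rewrite ler_peMl// -(expr1n _ 2) ler_sqr ?nnegrE//.
    exact: le_trans x1.
  - apply/measurable_funTS/measurable_EFinP; apply: continuous_measurable_fun => x.
    by apply: cvgB; [exact: csq|exact: cphi].
by rewrite -addeA [X in (_ + X)%E]addeC.
Qed.

Lemma integrable_gaussian_sqr :
  gamma.-integrable setT (EFin \o (fun x => x ^+ 2)).
Proof.
apply/integrableP; split.
  by apply/measurable_EFinP; exact: exprn_measurable.
under eq_integral do rewrite /= ger0_norm ?sqr_ge0//.
by rewrite ge0_gaussian_second_moment ltry.
Qed.

Lemma gaussian_second_moment : \int[gamma]_x (x ^+ 2) = 1.
Proof. by rewrite /Rintegral ge0_gaussian_second_moment. Qed.

Lemma gaussian_mean : \int[gamma]_x x = 0.
Proof.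
(* [p x] and [p (- x)] are the positive and negative parts of the identity. Reflection makes their
   integrals equal, and finiteness allows subtracting them. *)
pose p (x : R) := Num.max x 0.
have cp : continuous p.
  by move=> x; apply: (@continuous_max _ _ id (cst 0));
    [exact: cvg_id|exact: cvg_cst].
have p0 x : 0 <= p x by rewrite le_max lexx orbT.
have mp : measurable_fun setT p by exact: continuous_measurable_fun.
have cpN : continuous (p \o -%R).
  by move=> x; apply: continuous_comp; [exact: opp_continuous|exact: cp].
have mpN : measurable_fun setT (p \o -%R) by exact: continuous_measurable_fun.
have E : (\int[gamma]_x (p (- x))%:E = \int[gamma]_x (p x)%:E)%E.
  have p0E x : (0 <= (p x)%:E)%E by rewrite lee_fin.
  have mEp : measurable_fun setT (fun x => (p x)%:E) by exact/measurable_EFinP.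
  have mEpN : measurable_fun setT (fun x : R => (p (- x))%:E)
    by exact/measurable_EFinP.
  rewrite (ge0_integral_normal_prob mEpN (fun x => p0E (- x))).
  rewrite (ge0_integral_normal_prob mEp p0E).
  under eq_integral do rewrite -EFinM.
  under [in RHS]eq_integral do rewrite -EFinM.
  (* [p (- x)] vanishes on the positive half-line; [- 0] is the form of the bound in the reflection
     formula. *)
  transitivity (\int[mu]_(x in `]-oo, (- 0)%R]) (p (- x) * phi x)%:E)%E.
    rewrite [RHS]integral_mkcond; apply: eq_integral => x _.
    rewrite patchE; case: ifPn => //; rewrite notin_setE/= in_itv/= oppr0.
    move=> /negP; rewrite -ltNge => x0.
    by rewrite /p max_r ?mul0r// oppr_le0 ltW.
  rewrite ge0_integration_by_substitutionNy; last 2 first.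
  - by apply: continuous_subspaceT => x; apply: cvgM; [exact: cpN|exact: cphi].
  - by move=> x _; rewrite mulr_ge0.
  rewrite [LHS]integral_mkcond; apply: eq_integral => x _.
  rewrite patchE; case: ifPn => /=; first by rewrite opprK phiN.
  rewrite notin_setE/= in_itv/= andbT => /negP; rewrite -ltNge => x0.
  by rewrite /p max_r ?mul0r// ltW.
have pE : (EFin \o (fun x : R => x))^\+%E = (fun x => (p x)%:E).
  by apply/funext => x; rewrite funeposE/= /p EFin_max.
have nE : (EFin \o (fun x : R => x))^\-%E = (fun x => (p (- x))%:E).
  by apply/funext => x; rewrite funenegE/= /p EFin_max.
rewrite /Rintegral integralE pE nE E subee//.
have ip : gamma.-integrable setT (EFin \o p).
  have ii : gamma.-integrable setT (EFin \o (fun x => x)).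
    exact: integrable_sqr integrable_gaussian_sqr.
  apply: le_integrable_EFin (integrable_norm ii) => // x.
  by rewrite (ger0_norm (p0 x)) /= ge_max ler_norm normr_ge0.
exact: integrable_fin_num ip.
Qed.

End gaussian_moments.

(** * Smoothing and Taylor remainders *)

Section smoothing.
Context {R : realType}.
Implicit Types f g F : R -> R.

Definition unif_cont f := forall e, 0 < e -> exists2 del : R, 0 < del &
  forall x y, `|x - y| <= del -> `|f x - f y| <= e.

Lemma unif_cont_continuous f : unif_cont f -> continuous f.
Proof.
move=> uf x; apply/cvgrPdist_le => e e0; have [del d0 h] := uf e e0.
near=> y; apply: h; near: y.
exact: (@cvgr_dist_le _ _ _ _ _ id x (@cvg_id _ _)).
Unshelve. all: by end_near. Qed.

Lemma primitive_exists f : continuous f ->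
  exists F : R -> R, forall x : R, is_derive x 1 F (f x).
Proof.
move=> cf; pose mu := @lebesgue_measure R.
have fi a b : mu.-integrable `[a, b] (EFin \o f).
  apply: continuous_compact_integrable; first exact: segment_compact.
  exact: continuous_subspaceT.
pose I a x := \int[mu]_(t in `[a, x]) f t.
(* An integral over [[a, x]] vanishes for [x < a] instead of changing sign, so the base point moves
   with [x] to stay left of both [x] and 0. Subtracting the part up to 0 makes the value independent
   of the base point, which is [FE]. *)
pose F x := I (- (`|x| + 1)) x - I (- (`|x| + 1)) 0.
have IB a b x : a <= b -> b <= x -> I a x = I a b + I b x.
  move=> ab bx; apply/eqP; rewrite addrC -subr_eq; apply/eqP.
  rewrite /I Rintegral_itvB// ?bnd_simp//; last first.
  rewrite Rintegral_itv_obnd_cbnd//.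
  apply: integrableS (fi b x) => //; apply: subset_itvr; rewrite bnd_simp//.
have FE a x : a <= 0 -> a <= x -> F x = I a x - I a 0.
  move=> a0 ax; rewrite /F; set b := - (_ + 1).
  have b0 : b <= 0 by rewrite /b oppr_le0 addr_ge0.
  have bx : b <= x by rewrite /b lerNl (le_trans (ler_norm _))// normrN lerDl.
  have [ab|/ltW ba] := leP a b.
    by rewrite (IB a b x)// (IB a b 0)//; ring.
  by rewrite (IB b a x)// (IB b a 0)//; ring.
exists F => x.
pose a := - (`|x| + 1).
have a0 : a < 0 by rewrite /a oppr_lt0 ltr_wpDl.
have ax : a < x.
  by rewrite /a ltrNl (le_lt_trans (ler_norm _))// normrN ltrDl.
have [] := @continuous_FTC1_closed R f a x (x + 1) _ (fi _ _) ax (cf x).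
  by rewrite ltrDl.
move=> dI IE.
have near_eq : \forall y \near x, I a y - I a 0 = F y.
  near=> y; rewrite (FE a)//; first exact: ltW.
  by apply/ltW; near: y; exact: lt_nbhsr.
apply: (near_eq_is_derive near_eq).
have : is_derive x 1 (I a) (f x) by apply: DeriveDef => //; rewrite -derive1E.
move=> h; have := is_deriveB h (is_derive_cst (I a 0) x 1).
by rewrite subr0.
Unshelve. all: by end_near. Qed.

Lemma mvt_at F f x h : (forall y : R, is_derive y 1 F (f y)) ->
  exists2 c : R, `|c| <= `|h| & F (x + h) - F x = h * f (x + c).
Proof.
move=> dF.
have cF : continuous F by move=> y; apply/differentiable_continuous/derivable1_diffP.
have [h0|h0] := leP 0 h.
  have [||c] := @MVT_segment _ F f x (x + h) _ (fun y _ => dF y).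
  - by rewrite lerDl.
  - exact: continuous_subspaceT.
  rewrite in_itv/= => /andP[xc cx] E; exists (c - x).
    rewrite !ger0_norm//; first by rewrite lerBlDl.
    by rewrite subr_ge0.
  by rewrite E addrCA subrr addr0 addrAC subrr add0r mulrC.
have [||c] := @MVT_segment _ F f (x + h) x _ (fun y _ => dF y).
- by rewrite gerDl ltW.
- exact: continuous_subspaceT.
rewrite in_itv/= => /andP[xc cx] E; exists (c - x).
  by rewrite !ler0_norm ?subr_le0// ?(ltW h0)// lerN2 lerBrDl.
rewrite addrCA subrr addr0 -opprB E; ring.
Qed.

(* The second-order Taylor remainder is o(h^2) uniformly in the base point, in
   a form that integrates well against a law with finite second moment. *)
Definition taylor2 (e C : R) f f1 f2 := forall x h,
  `|f (x + h) - f x - h * f1 x - h ^+ 2 / 2 * f2 x| <=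
  h ^+ 2 * (e + C * Num.min 1 `|h|).

Lemma taylor2_of_derive f f1 f2 (M : R) :
  (forall x : R, is_derive x 1 f (f1 x)) -> (forall x : R, is_derive x 1 f1 (f2 x)) ->
  unif_cont f2 -> (forall x, `|f2 x| <= M) ->
  forall e, 0 < e -> exists2 C : R, 0 <= C & taylor2 e C f f1 f2.
Proof.
move=> d1 d2 uf2 f2M e e0; have [del del0 hdel] := uf2 e e0.
have M0 : 0 <= M by rewrite (le_trans _ (f2M 0)).
(* For [|h| > del] the crude bound [2 * M] has to be absorbed by [C * min(1, |h|)]. That minimum is
   at least [min(1, del)], whose inverse is the factor [max(1, 1/del)]. *)
pose C := 2 * M * Num.max 1 del^-1.
have C0 : 0 <= C by rewrite !mulr_ge0// le_max ler01.
exists C => // x h.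
have bound c : `|c| <= `|h| -> `|f2 (x + c) - f2 x| <= e + C * Num.min 1 `|h|.
  move=> ch; have [hd|hd] := leP `|h| del.
    apply: (@le_trans _ _ e).
      by apply: hdel; rewrite addrAC subrr add0r (le_trans ch).
    by rewrite lerDl mulr_ge0// le_min ler01/=.
  apply: (@le_trans _ _ (2 * M)).
    by apply: le_trans (ler_normB _ _) _; have := f2M (x + c); have := f2M x; lra.
  apply: (@le_trans _ _ (C * Num.min 1 `|h|)); last by rewrite lerDr ltW.
  rewrite /C -mulrA ler_peMr ?mulr_ge0//.
  have m0 : 0 <= Num.min 1 `|h| by rewrite le_min ler01/=.
  have [h1|h1] := leP 1 `|h|.
    by rewrite mulr1 le_max lexx.
  apply: (@le_trans _ _ (del^-1 * `|h|)); last first.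
    by rewrite ler_wpM2r// le_max lexx orbT.
  by rewrite mulrC ler_pdivlMr// mul1r ltW.
(* [G] is the remainder as a function of the increment, with derivatives [G1] and [G2]. As [G] and
   [G1] vanish at 0, two uses of the mean value theorem give [G h = h * (c * G2 c')] with
   [|c'| <= |c| <= |h|]; the lost factor 1/2 is harmless. *)
pose G t := f (x + t) - f x - t * f1 x - t ^+ 2 / 2 * f2 x.
pose G1 t := f1 (x + t) - f1 x - t * f2 x.
pose G2 t := f2 (x + t) - f2 x.
have dsh (k k' : R -> R) : (forall y : R, is_derive y 1 k (k' y)) ->
    forall t : R, is_derive t 1 (fun t => k (x + t)) (k' (x + t)).
  move=> dk t.
  have dadd : is_derive t 1 (fun t : R^o => x + t : R^o) 1.
    have := is_deriveD (is_derive_cst (x : R^o) t 1) (is_derive_id t 1).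
    by rewrite add0r.
  have := @is_derive1_comp _ k (fun t => x + t) t _ _ (dk _) dadd.
  by rewrite mulr1.
have dG (t : R) : is_derive t 1 G (G1 t).
  have D1 := dsh _ _ d1 t.
  rewrite /G /G1; apply: is_derive_eq; rewrite /GRing.scale/=.
  by field.
have dG1 (t : R) : is_derive t 1 G1 (G2 t).
  have D1 := dsh _ _ d2 t.
  rewrite /G1 /G2; apply: is_derive_eq; rewrite /GRing.scale/=.
  by ring.
have [c ch E] := @mvt_at G G1 0 h dG.
have [c' ch' E'] := @mvt_at G1 G2 0 c dG1.
rewrite -/(G h).
have G0 : G 0 = 0 by rewrite /G addr0 expr0n/= !mul0r subrr !subr0.
have G10 : G1 0 = 0 by rewrite /G1 addr0 mul0r subrr subr0.
move: E E'; rewrite !add0r G0 G10 !subr0 => -> ->.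
rewrite !normrM -(real_normK (num_real h)) expr2 -mulrA ler_wpM2l//.
by apply: ler_pM => //; apply: bound; exact: le_trans ch' ch.
Qed.

(* Averaging twice over a window of length del gives two derivatives; by the
   mean value theorem the average is a value of f at a nearby point. *)
Lemma smooth_approx f (M : R) : unif_cont f -> (forall x, `|f x| <= M) ->
  forall e, 0 < e -> exists g g1 g2 : R -> R, exists M' : R,
  [/\ forall x, `|f x - g x| <= e,
      [/\ continuous g, continuous g1 & continuous g2],
      [/\ forall x, `|g x| <= M', forall x, `|g1 x| <= M' & forall x, `|g2 x| <= M'] &
      forall e', 0 < e' -> exists2 C : R, 0 <= C & taylor2 e' C g g1 g2].
Proof.
move=> uf fM e e0; have cf := unif_cont_continuous uf.
have [del0 del00 hdel] := uf e e0.
(* Two windows of length [del] move the argument by at most [del0]. *)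
pose del := del0 / 2; have d0 : 0 < del by rewrite divr_gt0.
have dn0 : del != 0 by rewrite gt_eqF.
have [F dF] := primitive_exists cf.
have cF : continuous F by move=> y; apply/differentiable_continuous/derivable1_diffP.
have [G dG] := primitive_exists cF.
have cG : continuous G by move=> y; apply/differentiable_continuous/derivable1_diffP.
(* [D k] is the average of the derivative of [k] over [[x, x + del]]. Since [f] is the second
   derivative of [G], [D (D G)] is the double average of [f], and differentiation commutes with
   [D]. *)
pose D (k : R -> R) x := del^-1 * (k (x + del) - k x).
have cD k : continuous k -> continuous (D k).
  move=> ck x; apply: cvgM; first exact: cvg_cst.
  apply: cvgB; last exact: ck.
  apply: (@continuous_comp _ _ _ (fun x => x + del) k); last exact: ck.
  by apply: cvgD; [exact: cvg_id|exact: cvg_cst].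
have dD k k' : (forall y : R, is_derive y 1 k (k' y)) ->
    forall y : R, is_derive y 1 (D k) (D k' y).
  move=> dk y.
  have dadd : is_derive y 1 (fun t : R^o => t + del : R^o) 1.
    have := is_deriveD (is_derive_id y 1) (is_derive_cst (del : R^o) y 1).
    by rewrite addr0.
  have h := @is_derive1_comp _ k (fun t => t + del) y _ _ (dk _) dadd.
  have dk' : is_derive y 1 (fun t => k (t + del)) (k' (y + del)).
    by move: h; rewrite mulr1.
  have dky := dk y.
  by rewrite /D; apply: is_derive_eq.
have vD k k' : (forall y : R, is_derive y 1 k (k' y)) ->
    forall x, exists2 c, `|c| <= del & D k x = k' (x + c).
  move=> dk x; have [c ch E] := @mvt_at k k' x del dk.
  exists c; first by rewrite (le_trans ch)// gtr0_norm.
  by rewrite /D E mulrA mulVf// mul1r.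
have bD k K : (forall x, `|k x| <= K) -> forall x, `|D k x| <= del^-1 * (K + K).
  move=> kK x; rewrite /D normrM gtr0_norm ?invr_gt0// ler_pM2l ?invr_gt0//.
  by apply: le_trans (ler_normB _ _) _; exact: lerD.
have DDG x : exists2 c, `|c| <= del0 & D (D G) x = f (x + c).
  have [c ch ->] := vD _ _ (dD _ _ dG) x.
  have [c' ch' ->] := vD _ _ dF (x + c).
  exists (c + c'); last by rewrite addrA.
  by apply: le_trans (ler_normD _ _) _; rewrite [leRHS]splitr lerD.
have DFM x : `|D F x| <= M by have [c _ ->] := vD _ _ dF x.
have M0 : 0 <= M by rewrite (le_trans _ (fM 0)).
pose M' := M + del^-1 * (M + M) + del^-1 * (del^-1 * (M + M) + del^-1 * (M + M)).
have i0 : 0 <= del^-1 by rewrite invr_ge0 ltW.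
have b1 : 0 <= del^-1 * (M + M) by rewrite mulr_ge0// addr_ge0.
have b2 : 0 <= del^-1 * (del^-1 * (M + M) + del^-1 * (M + M)).
  by rewrite mulr_ge0// addr_ge0.
exists (D (D G)), (D (D F)), (D (D f)), M'; split.
- by move=> x; have [c ch ->] := DDG x; apply: hdel; rewrite opprD addNKr normrN.
- by split; apply/cD/cD.
- split => x.
  + by have [c ch ->] := DDG x; rewrite (le_trans (fM _))// /M' -addrA lerDl addr_ge0.
  + by rewrite (le_trans (bD _ _ DFM x))// /M' addrAC lerDr addr_ge0.
  + by rewrite (le_trans (bD _ _ (bD _ _ fM) x))// /M' lerDr addr_ge0.
- apply: (@taylor2_of_derive _ _ _ (del^-1 * (del^-1 * (M + M) + del^-1 * (M + M)))).
  + have uD k : unif_cont k -> unif_cont (D k).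
      move=> uk r r0; have r'0 : 0 < r * del / 2 by rewrite divr_gt0// mulr_gt0.
      have [eta eta0 heta] := uk _ r'0; exists eta => // x y xy.
      rewrite /D -mulrBr normrM gtr0_norm ?invr_gt0// ler_pdivrMl// mulrC.
      have -> : k (x + del) - k x - (k (y + del) - k y) =
        (k (x + del) - k (y + del)) - (k x - k y) by ring.
      apply: le_trans (ler_normB _ _) _; rewrite [leRHS]splitr; apply: lerD.
        by apply: heta; rewrite opprD addrACA subrr addr0.
      exact: heta.
    exact/uD/uD.
  + exact: (bD _ _ (bD _ _ fM)).
Qed.

(** Heine-Cantor on [[- K, K]], composed with the clamp, which is 1-Lipschitz. The clamped function
    agrees with [f] on [[- K, K]], so under tightness it can stand in for [f]. *)
Lemma clamp_unif_cont f (K : R) : continuous f -> 0 < K ->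
  unif_cont (fun x => f (Num.max (- K) (Num.min K x))).
Proof.
move=> cf K0 e e0.
pose Q (del x : R) := forall y, `|x - y| <= del -> `|f x - f y| <= e.
have : \forall del \near (0 : R)^'+, `[- K, K]%classic `<=` Q del.
  have /compact_near_coveringP := @segment_compact R (- K) K.
  apply => x _.
  have e20 : 0 < e / 2 by rewrite divr_gt0.
  have /cvgrPdist_le/(_ (e / 2) e20) [r /= r0 hr] := cf x.
  (* [|x - x'| < r / 2] and [|x' - y| <= r / 4] keep [x'] and [y] within [r] of [x]. *)
  exists (ball x (r / 2), [set del | del <= r / 4]).
    split; first by apply: nbhsx_ballx; rewrite divr_gt0.
    by apply: nbhs_right_le; rewrite divr_gt0.
  move=> [x' del] /= [xx' delr] y xy.
  rewrite /ball/= in xx'.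
  have h1 : `|f x - f x'| <= e / 2.
    by apply: hr; rewrite /ball/= (lt_trans xx')// ltr_pdivrMr// ltr_pMr// ltr1n.
  have h2 : `|f x - f y| <= e / 2.
    apply: hr; rewrite /ball/=.
    rewrite -(subrKA x') (le_lt_trans (ler_normD _ _))//.
    have : `|x' - y| <= r / 4 by exact: le_trans delr.
    by move: xx'; set a := `|_ - x'|; set b := `|_ - y|; move: r0; lra.
  have -> : f x' - f y = (f x - f y) - (f x - f x') by ring.
  by rewrite (le_trans (ler_normB _ _))// [leRHS]splitr lerD.
move=> h.
have [del [del0 hdel]] : exists del : R, 0 < del /\ `[- K, K]%classic `<=` Q del.
  near (0 : R)^'+ => del; exists del; split => //.
  by near: del; exact: h.
exists del => // x y xy.
apply: hdel.
  by rewrite /= in_itv/= le_max lexx/= ge_max ge_min lexx/= andbT; lra.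
have lip_max (a u v : R) : `|Num.max a u - Num.max a v| <= `|u - v|.
  have := ler_norm (u - v); have := ler_norm (v - u).
  rewrite [in X in X -> _]distrC; move: `|u - v| => n; rewrite /Order.max.
  by do 2 (case: ifPn; rewrite -?leNgt => ?); rewrite ler_norml; lra.
have lip_min (a u v : R) : `|Num.min a u - Num.min a v| <= `|u - v|.
  have := ler_norm (u - v); have := ler_norm (v - u).
  rewrite [in X in X -> _]distrC; move: `|u - v| => n; rewrite /Order.min.
  by do 2 (case: ifPn; rewrite -?leNgt => ?); rewrite ler_norml; lra.
exact: le_trans (lip_max _ _ _) (le_trans (lip_min _ _ _) xy).
Unshelve. all: by end_near. Qed.

End smoothing.

(** * The central limit theorem *)

Section expected_shift.
Context {d} {T : measurableType d} {R : realType} (P : probability T R).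

(** The averaging operator of an independent increment [a * X]. For standard Gaussian [X] it is the
    heat semigroup at time [a ^+ 2], with half the second derivative as generator. *)
Definition expected_shift (X : T -> R) (a : R) (f : R -> R) (x : R) : R :=
  \int[P]_t f (x + a * X t).

Variable X : T -> R.
Hypothesis mX : measurable_fun setT X.
Implicit Types f g : R -> R.

Let msh a x : measurable_fun setT (fun t => x + a * X t).
Proof. by apply: measurable_funD => //; exact: measurable_funM. Qed.

Lemma integrable_shift a f (M : R) x : measurable_fun setT f ->
  (forall x, `|f x| <= M) -> P.-integrable setT (EFin \o (fun t => f (x + a * X t))).
Proof.
move=> mf fM; apply: (@bounded_integrable _ _ _ P _ M) => //.
exact: measurableT_comp mf (msh a x).
Qed.

Lemma expected_shift_bounded a f (M : R) : measurable_fun setT f ->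
  (forall x, `|f x| <= M) -> forall x, `|expected_shift X a f x| <= M.
Proof.
move=> mf fM x; apply: normr_Rintegral_le => //.
exact: measurableT_comp mf (msh a x).
Qed.

Lemma measurable_expected_shift a f (M : R) : measurable_fun setT f ->
  (forall x, `|f x| <= M) -> measurable_fun setT (expected_shift X a f).
Proof.
move=> mf fM.
have fM0 x : 0 <= f x + M by have := fM x; rewrite ler_norml; lra.
pose h (w : R * T) := (f (w.1 + a * X w.2) + M)%:E.
have mh : measurable_fun setT h.
  apply/measurable_EFinP; apply: measurable_funD => //.
  apply: measurableT_comp => //; apply: measurable_funD => //.
  by apply: measurable_funM => //; exact: measurableT_comp.
have h0 w : (0 <= h w)%E by rewrite lee_fin.
have mF := measurable_fun_fubini_tonelli_F (m2 := P) h mh h0.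
rewrite (_ : expected_shift _ _ _ = (fun x => fine (fubini_F P h x) - M)).
  by apply: measurable_funB => //;
    exact: measurableT_comp (fine_measurable measurableT) mF.
apply/funext => x; rewrite /expected_shift -[fine _]/(\int[P]_t (f (x + a * X t) + M)).
rewrite RintegralD//; first by rewrite Rintegral_prob_cst addrK.
- exact: integrable_shift mf fM.
- by apply: (@bounded_integrable _ _ _ P _ `|M|).
Qed.

Lemma expected_shift0 f x : expected_shift X 0 f x = f x.
Proof.
rewrite /expected_shift; under eq_Rintegral do rewrite mul0r addr0.
exact: Rintegral_prob_cst.
Qed.

(** The bound in [taylor2] is uniform in the base point, so averaging over base points preserves [e]
    and [C]. This replaces differentiation under the integral sign: [f1] and [f2] are averaged along
    with [f]. *)
Lemma taylor2_expected_shift b (e C M : R) f f1 f2 :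
  measurable_fun setT f -> measurable_fun setT f1 -> measurable_fun setT f2 ->
  (forall x, `|f x| <= M) -> (forall x, `|f1 x| <= M) -> (forall x, `|f2 x| <= M) ->
  taylor2 e C f f1 f2 ->
  taylor2 e C (expected_shift X b f) (expected_shift X b f1) (expected_shift X b f2).
Proof.
move=> mf mf1 mf2 fM f1M f2M tf x h.
have i1 := integrable_shift b (x + h) mf fM.
have i2 := integrable_shift b x mf fM.
have i3 := integrable_shift b x mf1 f1M.
have i4 := integrable_shift b x mf2 f2M.
rewrite /expected_shift -RintegralZl// -RintegralZl// -!RintegralB//;
  try (by exact: integrable_EFinZ); try (by exact: integrable_EFinB);
  try (by apply: integrable_EFinB; [exact: integrable_EFinB|exact: integrable_EFinZ]).
apply: normr_Rintegral_le.
- apply: measurable_funB; last by apply: measurable_funM => //;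
  exact: measurableT_comp mf2 (msh b x).
  apply: measurable_funB; last by apply: measurable_funM => //;
    exact: measurableT_comp mf1 (msh b x).
  by apply: measurable_funB; apply: measurableT_comp mf _; exact: msh.
- by move=> t; rewrite (addrAC x h); exact: tf.
Qed.

Hypothesis X2 : P.-integrable setT (EFin \o (fun t => X t ^+ 2)).
Hypothesis EX : \int[P]_t X t = 0.

Let mmin a : measurable_fun setT (fun t => Num.min 1 `|a * X t|).
Proof.
by apply: measurable_minr => //; apply: measurableT_comp => //;
  exact: measurable_funM.
Qed.

(** The part [h^2 * min(1, |h|)] of the Taylor bound at [h = a * X], averaged, with [a ^+ 2]
    factored out. It plays the role of the truncated second moment in Lindeberg's condition. *)
Definition truncated_moment a := \int[P]_t (X t ^+ 2 * Num.min 1 `|a * X t|).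

Lemma integrable_truncated a :
  P.-integrable setT (EFin \o (fun t => X t ^+ 2 * Num.min 1 `|a * X t|)).
Proof.
apply: le_integrable_EFin X2.
  by apply: measurable_funM => //; exact: measurable_funX.
move=> t; rewrite ger0_norm.
  by rewrite ler_piMr ?sqr_ge0// ge_min lexx.
by rewrite mulr_ge0 ?sqr_ge0// le_min ler01/=.
Qed.

Lemma cvg_truncated_moment (a : nat -> R) : a n @[n --> \oo] --> 0 ->
  truncated_moment (a n) @[n --> \oo] --> 0.
Proof.
move=> a0.
have mtr n : measurable_fun setT (fun t => (X t ^+ 2 * Num.min 1 `|a n * X t|)%:E).
  exact: measurable_int (integrable_truncated (a n)).
have ptw : {ae P, forall t, setT t ->
    (X t ^+ 2 * Num.min 1 `|a n * X t|)%:E @[n --> \oo] --> 0%E}.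
  apply: aeW => t _; apply/fine_cvgP; split; first by near=> n.
  rewrite -[X in _ --> X](mulr0 (X t ^+ 2)).
  apply: cvgM; first exact: cvg_cst.
  apply/cvgr0Pnorm_le => e e0.
  have /cvgr0Pnorm_le : a n * X t @[n --> \oo] --> 0.
    by rewrite -[X in _ --> X](mul0r (X t)); apply: cvgM => //; exact: cvg_cst.
  move=> /(_ e e0); apply: filterS => n anX.
  by rewrite ger0_norm ?le_min ?ler01//= ge_min anX orbT.
have dom : {ae P, forall t n, setT t ->
    (`|(X t ^+ 2 * Num.min 1 `|a n * X t|)%:E| <= (X t ^+ 2)%:E)%E}.
  apply: aeW => t n _; rewrite /= lee_fin ger0_norm.
    by rewrite ler_piMr ?sqr_ge0// ge_min lexx.
  by rewrite mulr_ge0 ?sqr_ge0// le_min ler01/=.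
have [_ _] := dominated_convergence measurableT mtr (@measurable_cst _ _ _ _ _ _) ptw X2 dom.
by rewrite integral0 => /fine_cvg.
Unshelve. all: by end_near. Qed.

Lemma expected_shift_taylor a (e C M : R) g g1 g2 x :
  measurable_fun setT g -> (forall x, `|g x| <= M) -> taylor2 e C g g1 g2 ->
  `|expected_shift X a g x - g x - a ^+ 2 * (\int[P]_t X t ^+ 2) / 2 * g2 x| <=
  a ^+ 2 * (e * (\int[P]_t X t ^+ 2) + C * truncated_moment a).
Proof.
move=> mg gM tg.
have Xi := integrable_sqr mX X2.
have i0 := integrable_shift a x mg gM.
have i1 : P.-integrable setT (EFin \o (fun t => g x)).
  by apply: (@bounded_integrable _ _ _ P _ `|g x|).
have i2 := integrable_EFinZ (a * g1 x) Xi.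
have i3 := integrable_EFinZ (a ^+ 2 / 2 * g2 x) X2.
have i01 := integrable_EFinB i0 i1.
have i012 := integrable_EFinB i01 i2.
have i0123 := integrable_EFinB i012 i3.
have j1 := integrable_EFinZ (a ^+ 2 * e) X2.
have j2 := integrable_EFinZ (a ^+ 2 * C) (integrable_truncated a).
have j12 := integrable_EFinD j1 j2.
have -> : expected_shift X a g x - g x - a ^+ 2 * (\int[P]_t X t ^+ 2) / 2 * g2 x =
  \int[P]_t (g (x + a * X t) - g x - a * g1 x * X t - a ^+ 2 / 2 * g2 x * X t ^+ 2).
  rewrite RintegralB// RintegralB// RintegralB// Rintegral_prob_cst.
  by rewrite RintegralZl// RintegralZl// EX /expected_shift; ring.
have -> : a ^+ 2 * (e * (\int[P]_t X t ^+ 2) + C * truncated_moment a) =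
  \int[P]_t (a ^+ 2 * e * X t ^+ 2 + a ^+ 2 * C * (X t ^+ 2 * Num.min 1 `|a * X t|)).
  rewrite RintegralD// RintegralZl// RintegralZl//; last exact: integrable_truncated.
  by rewrite /truncated_moment; ring.
apply: le_normr_Rintegral_bound => // t.
have := tg x (a * X t).
rewrite (_ : a * X t * g1 x = a * g1 x * X t); last by ring.
rewrite (_ : (a * X t) ^+ 2 / 2 * g2 x = a ^+ 2 / 2 * g2 x * X t ^+ 2); last by field.
by move=> /le_trans; apply; rewrite le_eqVlt; apply/orP; left; apply/eqP; ring.
Qed.

End expected_shift.

Section gaussian_shift.
Context {R : realType}.
Local Notation gamma := (@normal_prob R 0 1).
Local Notation gshift := (@expected_shift _ _ R gamma (fun y => y)).

(** Semigroup law: variances add up. Adding [M] makes the function nonnegative for the Tonelli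
    argument, and [M] cancels at the end. *)
Lemma gaussian_shift_stable (f : R -> R) (M a b c x : R) :
  continuous f -> (forall x, `|f x| <= M) -> 0 <= a -> 0 <= b -> 0 <= c ->
  c ^+ 2 = a ^+ 2 + b ^+ 2 ->
  gshift a (gshift b f) x = gshift c f x.
Proof.
move=> cf fM a0 b0 c0 cab.
have mf : measurable_fun setT f by exact: continuous_measurable_fun.
(* The substitution behind [ge0_gaussian_stable] divides by [b]. The case [b = 0] does occur: it is
   the last exchange, after which no Gaussian is left. *)
have [b_0|bn0] := eqVneq b 0.
  have -> : c = a.
    by apply/eqP; rewrite -(eqrXn2 (n := 2))// cab b_0 expr0n/= addr0.
  by rewrite b_0 /expected_shift; apply: eq_Rintegral => y _;
    exact: (expected_shift0 gamma (fun y => y)).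
have bgt : 0 < b by rewrite lt0r bn0.
have cgt : 0 < c.
  rewrite lt0r c0 andbT; apply/eqP => c_0; move: cab; rewrite c_0 expr0n/=.
  by have := exprn_gt0 2 bgt; have := sqr_ge0 a; lra.
pose h u := f (x + u) + M.
have h0 u : 0 <= h u by rewrite /h; have := fM (x + u); rewrite ler_norml; lra.
have ch : continuous h.
  move=> u; apply: cvgD; last exact: cvg_cst.
  apply: (@continuous_comp _ _ _ (fun u => x + u) f); last exact: cf.
  by apply: cvgD; [exact: cvg_cst|exact: cvg_id].
have stab := @ge0_gaussian_stable R h a b c bgt cgt cab ch h0.
have mid : measurable_fun setT (fun y : measurableTypeR R => y : R) by [].
have ish k z := integrable_shift gamma mid k z mf fM.
have iM : gamma.-integrable setT (EFin \o (fun=> M)).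
  by apply: (@bounded_integrable _ _ _ gamma _ `|M|).
have hE k z : (\int[gamma]_y (f (z + k * y) + M)%:E)%E = (gshift k f z + M)%:E.
  rewrite -[RHS]fineK//; rewrite /expected_shift.
  have -> : \int[gamma]_t f (z + k * t) + M = \int[gamma]_t (f (z + k * t) + M).
    by rewrite RintegralD// Rintegral_prob_cst.
  rewrite /Rintegral /= fineK//.
  exact: integrable_fin_num (integrable_EFinD (ish k z) iM).
have inner y : (\int[gamma]_z (h (a * y + b * z))%:E)%E = (gshift b f (x + a * y) + M)%:E.
  by rewrite -hE; apply: eq_integral => z _; rewrite /h addrA.
have : (\int[gamma]_y (gshift b f (x + a * y) + M)%:E = (gshift c f x + M)%:E)%E.
  rewrite -hE -[RHS]stab; apply: eq_integral => y _.
  by rewrite inner.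
have mg := measurable_expected_shift gamma mid b mf fM.
have gM := expected_shift_bounded gamma mid b mf fM.
move=> /(congr1 fine); rewrite -[LHS]/(\int[gamma]_y (gshift b f (x + a * y) + M)).
rewrite RintegralD//; last exact: integrable_shift mg gM.
by rewrite Rintegral_prob_cst/= => /addIr.
Qed.

End gaussian_shift.

(** * Lindeberg's replacement argument *)

Section central_limit.
Context {d} {T : measurableType d} {R : realType} (P : probability T R).
Local Notation gamma := (@normal_prob R 0 1).
Local Notation gshift := (@expected_shift _ _ R gamma (fun y => y)).

Variable X : nat -> T -> R.
Hypothesis mX : forall i, measurable_fun setT (X i).
Hypothesis iX : mutually_independent P X.
Hypothesis idX : identically_distributed P X.
Hypothesis X2 : P.-integrable setT (EFin \o (fun t => X 0 t ^+ 2)).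
Hypothesis EX : \int[P]_t X 0 t = 0.

Let v := \int[P]_t X 0 t ^+ 2.
Let s := Num.sqrt v.
Let S n t := \sum_(i < n) X i t.

Let v0 : 0 <= v.
Proof. by apply: Rintegral_ge0 => t _; exact: sqr_ge0. Qed.

Let sE : s ^+ 2 = v. Proof. by rewrite sqr_sqrtr. Qed.

Let mid : measurable_fun setT (fun y : measurableTypeR R => y : R).
Proof. by []. Qed.

Let gtrunc := truncated_moment gamma (fun y => y).

(* One replacement step: X k / sqrt n is exchanged for a centred Gaussian of
   the same variance; only the two Taylor remainders survive. *)
Let replacement (n k : nat) (e C M : R) (g g1 g2 : R -> R) : (0 < n)%N ->
  measurable_fun setT g -> (forall x, `|g x| <= M) -> taylor2 e C g g1 g2 ->
  forall a, a = (Num.sqrt n%:R)^-1 ->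
  `|\int[P]_t g (a * S k.+1 t) - \int[P]_t gshift (s * a) g (a * S k t)| <=
  n%:R^-1 * (2 * e * v + C * (truncated_moment P (X 0) a + v * gtrunc (s * a))).
Proof.
move=> n0 mg gM tg a aE.
have a2 : a ^+ 2 = n%:R^-1 by rewrite aE exprVn sqr_sqrtr ?ler0n.
have mS := measurable_partial_sum mX k.
have mscale c : measurable_fun setT (fun x : R => c * x) by exact: measurable_funM.
(* Independence from [S k] integrates [X k] out, and identical distribution then replaces it by
   [X 0]. *)
have E1 : \int[P]_t g (a * S k.+1 t) =
    \int[P]_t expected_shift P (X 0) a g (a * S k t).
  under eq_Rintegral do rewrite /S big_ord_recr/= mulrDr.
  pose h (z : R * R) := g (a * z.1 + a * z.2).
  have mh : measurable_fun setT h.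
    apply: measurableT_comp => //.
    by apply: measurable_funD; apply: measurableT_comp (mscale a) _.
  rewrite (Rintegral_independent2 mS (mX k) (independent2_partial_sum mX iX k) mh) /=.
  - apply: eq_Rintegral => t _; rewrite /h/=.
    apply: (identically_distributed_Rintegral mX idX (g := fun w => g (_ + a * w))).
      apply: measurableT_comp => //; apply: measurable_funD => //.
    exact: (integrable_shift P (mX 0) a _ mg gM).
  - apply: (@bounded_integrable _ _ _ P _ M) => [|t]; last exact: gM.
    by apply: measurableT_comp mh _; exact: measurable_fun_pair.
  - move=> x; exact: (integrable_shift P (mX k) a (a * x) mg gM).
have mA := measurable_expected_shift P (mX 0) a mg gM.
have mB := measurable_expected_shift gamma mid (s * a) mg gM.
have bA := expected_shift_bounded P (mX 0) a mg gM.
have bB := expected_shift_bounded gamma mid (s * a) mg gM.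
have mSa : measurable_fun setT (fun t => a * S k t)
  by exact: measurableT_comp (mscale a) mS.
have iA : P.-integrable setT (EFin \o (fun t =>
  expected_shift P (X 0) a g (a * S k t))).
  by apply: (@bounded_integrable _ _ _ P _ M) => //; exact: measurableT_comp mA mSa.
have iB : P.-integrable setT (EFin \o (fun t => gshift (s * a) g (a * S k t))).
  by apply: (@bounded_integrable _ _ _ P _ M) => //; exact: measurableT_comp mB mSa.
rewrite E1 -RintegralB//; apply: normr_Rintegral_le.
  by apply: measurable_funB;
    [exact: measurableT_comp mA mSa|exact: measurableT_comp mB mSa].
move=> t; set x := a * S k t.
have hA := expected_shift_taylor (mX 0) X2 EX a x mg gM tg.
have hB := expected_shift_taylor mid integrable_gaussian_sqr gaussian_mean (s * a) x mg gM tg.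
move: hA hB; rewrite gaussian_second_moment exprMn sE a2 -/v -/gtrunc !mulr1 (mulrC v).
set A := expected_shift P _ _ _ _; set B := gshift _ _ _.
(* [q] is the quadratic term of both expansions, because [(s * a) ^+ 2 = a ^+ 2 * v], and it cancels
   in the difference. *)
set q := n%:R^-1 * v / 2 * g2 x => hA hB.
have -> : A - B = (A - g x - q) - (B - g x - q) by ring.
apply: le_trans (ler_normB _ _) _; apply: le_trans (lerD hA hB) _.
by rewrite le_eqVlt; apply/orP; left; apply/eqP; ring.
Qed.

(** Telescoping along hybrid sums: [E k] keeps [k] true summands and fuses the other [n - k]
    Gaussians into one. Each of the [n] exchanges costs [r / n]. *)
Let lindeberg (n : nat) (e C M : R) (f f1 f2 : R -> R) : (0 < n)%N ->
  continuous f -> continuous f1 -> continuous f2 ->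
  (forall x, `|f x| <= M) -> (forall x, `|f1 x| <= M) -> (forall x, `|f2 x| <= M) ->
  taylor2 e C f f1 f2 ->
  forall a, a = (Num.sqrt n%:R)^-1 ->
  `|\int[P]_t f (a * S n t) - gshift s f 0| <=
  2 * e * v + C * (truncated_moment P (X 0) a + v * gtrunc (s * a)).
Proof.
move=> n0 cf cf1 cf2 fM f1M f2M tf a aE.
have nR : 0 < (n%:R : R) by rewrite ltr0n.
have mf : measurable_fun setT f by exact: continuous_measurable_fun.
have mf1 : measurable_fun setT f1 by exact: continuous_measurable_fun.
have mf2 : measurable_fun setT f2 by exact: continuous_measurable_fun.
set r := 2 * e * v + _.
(* Standard deviation of [n - k] Gaussians of variance [v / n] each: [c n = 0] gives back [f], and
   [c 0 = s] is the full Gaussian. *)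
pose c k := s * Num.sqrt ((n - k)%:R / n%:R).
have c0 k : 0 <= c k by rewrite mulr_ge0 ?sqrtr_ge0.
pose E k := \int[P]_t gshift (c k) f (a * S k t).
have cS k : (k < n)%N -> c k ^+ 2 = (s * a) ^+ 2 + c k.+1 ^+ 2.
  move=> kn; rewrite !exprMn -mulrDr; congr (_ * _).
  rewrite !sqr_sqrtr ?divr_ge0 ?ler0n// aE exprVn sqr_sqrtr ?ler0n//.
  by rewrite -{2}(mul1r n%:R^-1) -mulrDl nat1r subnSK.
have a0 : 0 <= a by rewrite aE invr_ge0 sqrtr_ge0.
have step k : (k < n)%N -> `|E k.+1 - E k| <= n%:R^-1 * r.
  move=> kn; pose g := gshift (c k.+1) f.
  have -> : E k = \int[P]_t gshift (s * a) g (a * S k t).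
    apply: eq_Rintegral => t _; apply/esym.
    by apply: (gaussian_shift_stable _ cf fM) => //;
      [rewrite mulr_ge0 ?sqrtr_ge0|exact: cS].
  apply: (replacement k n0 (M := M) (g1 := gshift (c k.+1) f1) (g2 :=
    gshift (c k.+1) f2)).
  - exact: (measurable_expected_shift gamma mid _ mf fM).
  - exact: (expected_shift_bounded gamma mid _ mf fM).
  - exact: (taylor2_expected_shift gamma mid _ mf mf1 mf2 fM f1M f2M tf).
  - exact: aE.
have tele k : (k <= n)%N -> `|E k - E 0%N| <= k%:R * (n%:R^-1 * r).
  elim: k => [|k IH] kn; first by rewrite subrr normr0 mul0r.
  rewrite -(subrKA (E k)) -natr1 mulrDl mul1r [leRHS]addrC.
  apply: le_trans (ler_normD _ _) _; apply: lerD; first exact: step.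
  exact: IH (ltnW kn).
have En : E n = \int[P]_t f (a * S n t).
  apply: eq_Rintegral => t _; rewrite /c subnn mul0r sqrtr0 mulr0.
  exact: (expected_shift0 gamma (fun y => y)).
have E0 : E 0%N = gshift s f 0.
  rewrite /E /c subn0 divff ?gt_eqF// sqrtr1 mulr1.
  under eq_Rintegral do rewrite /S big_ord0 mulr0.
  exact: Rintegral_prob_cst.
by have := tele n (leqnn n); rewrite En E0 mulrA divff ?gt_eqF// mul1r.
Qed.

Lemma clt_unif_cont (f : R -> R) (M : R) : unif_cont f ->
  (forall x, `|f x| <= M) ->
  \int[P]_t f ((Num.sqrt n%:R)^-1 * S n t) @[n --> \oo] --> \int[gamma]_y f (s * y).
Proof.
move=> uf fM; apply/cvgrPdist_le => e e0.
have cf := unif_cont_continuous uf.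
have e40 : 0 < e / 4 by rewrite divr_gt0.
have [g [g1 [g2 [M' [fg [cg cg1 cg2] [gM g1M g2M] tg]]]]] := smooth_approx uf fM e40.
(* The budget is [e / 4] for each of four errors: [f] against [g] under [P], the same under [gamma],
   the term [2 * e' * v], and the truncated moments. The [+ 1] allows [v = 0]. *)
have e'0 : 0 < e / 4 / (2 * v + 1) by rewrite divr_gt0// ltr_wpDl// mulr_ge0.
have [C C0 tC] := tg _ e'0.
set e' := e / 4 / (2 * v + 1) in e'0 tC.
have e'v : 2 * e' * v <= e / 4.
  rewrite (_ : 2 * e' * v = e / 4 * (2 * v) / (2 * v + 1)); last by rewrite /e'; ring.
  have p0 : 0 < 2 * v + 1 by rewrite ltr_wpDl// mulr_ge0.
  by rewrite ler_pdivrMr// ler_pM2l// lerDl.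
have mf : measurable_fun setT f by exact: continuous_measurable_fun.
have mg : measurable_fun setT g by exact: continuous_measurable_fun.
pose a n : R := (Num.sqrt n%:R)^-1.
have a0 : a n @[n --> \oo] --> 0 by exact: cvg_inv_sqrt_nat.
have sa0 : s * a n @[n --> \oo] --> 0.
  by rewrite -[X in _ --> X](mulr0 s); apply: cvgM => //; exact: cvg_cst.
have D0 : C * (truncated_moment P (X 0)
  (a n) + v * gtrunc (s * a n)) @[n --> \oo] --> 0.
  rewrite -[X in _ --> X](mulr0 C); apply: cvgM; first exact: cvg_cst.
  rewrite -[X in _ --> X](addr0 0); apply: cvgD.
    exact: cvg_truncated_moment.
  rewrite -[X in _ --> X](mulr0 v); apply: cvgM; first exact: cvg_cst.
  by apply: cvg_truncated_moment sa0; [exact: mid|exact: integrable_gaussian_sqr].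
near=> n.
have n0 : (0 < n)%N by near: n; exact: nbhs_infty_gt.
have Dn : `|C * (truncated_moment P (X 0) (a n) + v * gtrunc (s * a n))| <= e / 4.
  by near: n; move/cvgr0Pnorm_le : D0; apply.
have mSa : measurable_fun setT (fun t => a n * S n t).
  by apply: measurable_funM => //; exact: measurable_partial_sum.
have L := lindeberg n0 cg cg1 cg2 gM g1M g2M tC (erefl (a n)).
have close d' (U : measurableType d') (Q : probability U R) (W : U -> R) :
    measurable_fun setT W -> `|\int[Q]_t f (W t) - \int[Q]_t g (W t)| <= e / 4.
  move=> mW.
  have mfW := measurableT_comp mf mW; have mgW := measurableT_comp mg mW.
  rewrite -RintegralB//; first last.
  - by apply: (@bounded_integrable _ _ _ Q _ M').
  - by apply: (@bounded_integrable _ _ _ Q _ M).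
  by apply: normr_Rintegral_le => //; exact: measurable_funB.
have h1 := close _ _ P _ mSa.
have mss : measurable_fun setT (fun y : measurableTypeR R => s * y : R)
  by exact: measurable_funM.
have h2 := close _ _ gamma _ mss.
have gE : gshift s g 0 = \int[gamma]_y g (s * y).
  by apply: eq_Rintegral => y _; rewrite add0r.
move: L; rewrite gE => L.
have L' : `|\int[P]_t g (a n * S n t) - \int[gamma]_y g (s * y)| <= e / 2.
  by apply: le_trans L _; move: Dn; rewrite ler_norml => /andP[_]; lra.
move: h1 h2 L'; rewrite !ler_norml.
set x1 := \int[P]_t f _; set x2 := \int[P]_t g _; set x3 := \int[gamma]_y g _;
  set x4 := \int[gamma]_y f _.
by lra.
Unshelve. all: by end_near. Qed.

End central_limit.

(** * Convergence in law *)

Section convergence_in_law.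
Context {d} {T : measurableType d} {R : realType} (P : probability T R).
Local Notation gamma := (@normal_prob R 0 1).

(** The inverse of [x] is [x] times the inverse of [x ^+ 2], which moves inversion to nonnegative
    numbers, where it is a real power; at 0 both sides are 0. *)
Lemma measurable_funV (f : T -> R) : measurable_fun setT f ->
  measurable_fun setT (fun t => (f t)^-1).
Proof.
move=> mf; rewrite (_ : (fun _ => _) = (fun t => f t * (f t ^+ 2) `^ (-1))).
  apply: measurable_funM => //.
  apply: (measurableT_comp (f := fun x : R => x `^ (-1)));
    first exact: measurable_powR.
  exact: measurable_funX.
apply/funext => t; have [->|ft0] := eqVneq (f t) 0; first by rewrite invr0 mul0r.
by rewrite powR_inv1 ?sqr_ge0// expr2 invfM mulrA divff// mul1r.
Qed.

Lemma gauss_expect_bounded (v M : R) (f : R -> R) : measurable_fun setT f ->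
  (forall x, `|f x| <= M) ->
  gauss_expect v f = (\int[gamma]_y f (Num.sqrt v * y))%:E.
Proof.
move=> mf fM; pose h y := f (Num.sqrt v * y).
have mh : measurable_fun setT (h : measurableTypeR R -> R).
  by apply: measurableT_comp => //; exact: measurable_funM.
have hM y : `|h y| <= M by exact: fM.
have hM0 y : 0 <= h y + M by have := hM y; rewrite ler_norml; lra.
have mphi : measurable_fun setT (@normal_pdf R 0 1) by exact: measurable_normal_pdf.
have phi0 y : 0 <= @normal_pdf R 0 1 y by exact: normal_pdf_ge0.
pose mu := @lebesgue_measure R.
have iphi : mu.-integrable setT (EFin \o @normal_pdf R 0 1)
  by exact: integrable_normal_pdf.
have ihphi : mu.-integrable setT (EFin \o (fun y => h y * normal_pdf 0 1 y)).
  apply: le_integrable_EFin (integrable_EFinZ M iphi); first exact: measurable_funM.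
  by move=> y; rewrite normrM (ger0_norm (phi0 y)) ler_wpM2r.
have ih : gamma.-integrable setT (EFin \o h)
  by exact: (@bounded_integrable _ _ _ gamma _ M).
have iM : gamma.-integrable setT (EFin \o (fun=> M)).
  by apply: (@bounded_integrable _ _ _ gamma _ `|M|).
have E1 : (\int[gamma]_y (h y + M)%:E = (\int[gamma]_y h y + M)%:E)%E.
  have -> : \int[gamma]_y h y + M = \int[gamma]_y (h y + M).
    by rewrite RintegralD// Rintegral_prob_cst.
  rewrite /Rintegral fineK//.
  exact: integrable_fin_num (integrable_EFinD ih iM).
have E2 : (\int[gamma]_y (h y + M)%:E =
    \int[mu]_y (h y * normal_pdf 0 1 y)%:E + M%:E)%E.
  rewrite ge0_integral_normal_prob; first last.
  - by move=> y; rewrite lee_fin.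
  - by apply/measurable_EFinP; exact: measurable_funD.
  under eq_integral do rewrite -EFinM mulrDl EFinD.
  rewrite integralD//; last exact: integrable_EFinZ.
  congr (_ + _)%E.
  under eq_integral do rewrite EFinM.
  by rewrite integralZl// integral_normal_pdf mule1.
move: E1; rewrite E2 EFinD => /eqP.
by rewrite eq_le leeD2rE// leeD2rE// -eq_le => /eqP.
Qed.

(** The quotient formula is assumed only where [p + b] is nonzero. Off a rare event
    [|b| <= |p| / 2], so the denominator stays at least [|p| / 2] in absolute value and the formula
    applies. *)
Lemma op1_ratio (X S e b : nat -> T -> R) (p : R) : p != 0 ->
  Op1 P S -> op1 P e -> op1 P b ->
  (\forall n \near \oo, forall t, p + b n t != 0 ->
    X n t = (S n t + e n t) / (p + b n t)) ->
  op1 P (fun n t => X n t - S n t / p).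
Proof.
move=> p0 oS oe ob XE.
have np0 : 0 < `|p| by rewrite normr_gt0.
(* The exact difference is [(p * e - S * b) / (p * (p + b))]; the lower bound on [|p + b|] yields
   the factor [2 / p ^+ 2]. *)
pose F n t := 2 / p ^+ 2 * (p * e n t + (-1) * (S n t * b n t)).
have oF : op1 P F by apply: op1Z; apply: op1D; [exact: op1Z|apply: op1Z;
  exact: Op1M_op1].
move=> r r0; have r20 : 0 < r / 2 by rewrite divr_gt0.
have del0 : 0 < Num.min (r / 2) (`|p| / 2) by rewrite lt_min r20 divr_gt0.
have hF := oF _ r20; have hb := ob _ del0.
near=> n.
have [A [mA PA AF]] : exists A, [/\ measurable A, (P A <= (r / 2)%:E)%E &
  forall t, ~ A t -> `|F n t| <= r / 2] by near: n.
have [B [mB PB Bb]] : exists A, [/\ measurable A,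
  (P A <= (Num.min (r / 2) (`|p| / 2))%:E)%E &
  forall t, ~ A t -> `|b n t| <= Num.min (r / 2) (`|p| / 2)] by near: n.
exists (A `|` B); split; first exact: measurableU.
  apply: le_trans (measureU2 P mA mB) _; rewrite [r]splitr EFinD leeD//.
  by apply: le_trans PB _; rewrite lee_fin ge_min lexx.
move=> t /not_orP[nA nB].
have bt : `|b n t| <= `|p| / 2.
  by apply: le_trans (Bb _ nB) _; rewrite ge_min lexx orbT.
have pb : `|p| / 2 <= `|p + b n t|.
  by have := ler_normB (p + b n t) (b n t); rewrite addrK; lra.
have pbt : p + b n t != 0 by rewrite -normr_gt0; apply: lt_le_trans pb;
  rewrite divr_gt0.
have Xn : forall t, p + b n t != 0 -> X n t = (S n t + e n t) / (p + b n t).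
  by near: n.
rewrite Xn//.
apply: le_trans (le_trans (AF _ nA) _); last by move: r0; lra.
have -> : (S n t + e n t) / (p + b n t) - S n t / p =
  (p * e n t + (-1) * (S n t * b n t)) / (p * (p + b n t)) by field; apply/andP.
rewrite /F normrM [leRHS]normrM [leRHS]mulrC.
apply: ler_wpM2l => //.
rewrite normfV normrM [leRHS]ger0_norm ?divr_ge0 ?sqr_ge0//.
rewrite -[leRHS]invrK lef_pV2 ?posrE ?mulr_gt0 ?normr_gt0 ?invr_gt0 ?divr_gt0 ?exprn_even_gt0//.
rewrite invf_div -(real_normK (num_real p)) expr2 -mulrA ler_wpM2l//.
Unshelve. all: by end_near. Qed.

Lemma slutsky_unif_cont (X Y : nat -> T -> R) (f : R -> R) (M l : R) :
  (forall n, measurable_fun setT (X n)) -> (forall n, measurable_fun setT (Y n)) ->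
  op1 P (fun n t => X n t - Y n t) -> unif_cont f -> (forall x, `|f x| <= M) ->
  \int[P]_t f (Y n t) @[n --> \oo] --> l ->
  \int[P]_t f (X n t) @[n --> \oo] --> l.
Proof.
move=> mX mY oXY uf fM /cvgrPdist_le Yl; apply/cvgrPdist_le => e e0.
have mf : measurable_fun setT f.
  by apply: continuous_measurable_fun; exact: unif_cont_continuous.
have M0 : 0 <= M by rewrite (le_trans _ (fM 0)).
have e30 : 0 < e / 3 by rewrite divr_gt0.
have [del del0 hdel] := uf _ e30.
(* At this probability the exceptional event costs at most [2 * M * (e / (6 * (M + 1))) <= e / 3];
   the [+ 1] allows [M = 0]. *)
have c0 : 0 < e / (6 * (M + 1)) by rewrite divr_gt0// mulr_gt0// ltr_wpDl.
have m0 : 0 < Num.min del (e / (6 * (M + 1))) by rewrite lt_min del0.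
have hXY := oXY _ m0; have hY := Yl _ e30.
near=> n.
have [A [mA PA AX]] : exists A, [/\ measurable A,
  (P A <= (Num.min del (e / (6 * (M + 1))))%:E)%E &
  forall t, ~ A t -> `|X n t - Y n t| <= Num.min del (e / (6 * (M + 1)))] by near: n.
have hn : `|l - \int[P]_t f (Y n t)| <= e / 3 by near: n.
have PA' : (P A <= (e / (6 * (M + 1)))%:E)%E.
  by apply: le_trans PA _; rewrite lee_fin ge_min lexx orbT.
have := @Rintegral_dist_off_event _ _ _ P (f \o X n) (f \o Y n) A M (e / 3) _
  (measurableT_comp mf (mX n)) (measurableT_comp mf (mY n)) mA
  (fun t => fM _) (fun t => fM _) (ltW e30) PA'.
have -> : e / 3 + 2 * M * (e / (6 * (M + 1))) = e / 3 + e / 3 * (M / (M + 1)).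
  by field; rewrite gt_eqF// ltr_wpDl.
have : M / (M + 1) <= 1 by rewrite ler_pdivrMr ?ltr_wpDl// mul1r lerDl.
set q := M / _ => q1 H.
have H' : `|\int[P]_t f (X n t) - \int[P]_t f (Y n t)| <= e / 3 + e / 3 * q.
  apply: H => t nA; apply: hdel; apply: le_trans (AX _ nA) _.
  by rewrite ge_min lexx.
have : e / 3 * q <= e / 3 by rewrite ler_piMr// ltW.
move: H' hn; rewrite !ler_norml.
by set x := \int[P]_t f (X n t); set y := \int[P]_t f (Y n t); lra.
Unshelve. all: by end_near. Qed.

(** The argument is clamped at a level [K] that serves both the sequence and the Gaussian limit.
    This changes each of the two expectations by at most [2 * M * c <= e / 4]. *)
Lemma cvg_in_law_of_unif_cont (X : nat -> T -> R) (v : R) :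
  (forall n, measurable_fun setT (X n)) -> Op1 P X ->
  (forall (f : R -> R) (M : R), unif_cont f -> (forall x, `|f x| <= M) ->
    \int[P]_t f (X n t) @[n --> \oo] --> \int[gamma]_y f (Num.sqrt v * y)) ->
  cvg_in_law_normal0 P X v.
Proof.
move=> mX oX H f cf [M fM].
have mf : measurable_fun setT f by exact: continuous_measurable_fun.
have M0 : 0 <= M by rewrite (le_trans _ (fM 0)).
rewrite (gauss_expect_bounded v mf fM).
have EE n : ('E_P[f \o X n])%E = (\int[P]_t f (X n t))%:E.
  rewrite unlock /Rintegral fineK//.
  have : P.-integrable setT (EFin \o (fun t => f (X n t))).
    by apply: (@bounded_integrable _ _ _ P _ M) => //;
      exact: measurableT_comp mf (mX n).
  exact: integrable_fin_num.
under eq_fun do rewrite EE.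
apply/fine_cvgP; split; first by near=> n.
rewrite /comp/=; apply/cvgrPdist_le => e e0.
pose c := e / (8 * (M + 1)).
have c0 : 0 < c by rewrite divr_gt0// mulr_gt0// ltr_wpDl.
have Mc : 2 * M * c <= e / 4.
  rewrite (_ : 2 * M * c = e / 4 * (M / (M + 1))); last first.
    by rewrite /c; field; rewrite gt_eqF// ltr_wpDl.
  by rewrite ler_piMr ?divr_ge0 ?ltW// ltr_pdivrMr ?ltr_wpDl// mul1r ltrDl.
have [K1 K10 hX] := oX c c0.
have msv : measurable_fun setT (fun y : measurableTypeR R => Num.sqrt v * y : R).
  exact: measurable_funM.
have isv : gamma.-integrable setT (EFin \o (fun y => (Num.sqrt v * y) ^+ 2)).
  apply: eq_integrable (integrable_EFinZ (Num.sqrt v ^+ 2) integrable_gaussian_sqr) => //.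
  by move=> y _; rewrite /= exprMn.
set w := \int[gamma]_y (Num.sqrt v * y) ^+ 2.
have w0 : 0 <= w by apply: Rintegral_ge0 => y _; exact: sqr_ge0.
have K20 : 0 < 1 + w / c by rewrite ltr_pwDl// divr_ge0// ltW.
have [B [mB PB BG]] := chebyshev_event msv K20 isv.
have PB' : (gamma B <= c%:E)%E.
  apply: le_trans PB _; rewrite lee_fin -/w ler_pdivrMr ?exprn_gt0//.
  have we : w = c * (w / c) by rewrite mulrCA divff ?gt_eqF// mulr1.
  have u0 : 0 <= w / c by rewrite divr_ge0// ltW.
  by rewrite {1}we ler_pM2l//; nra.
pose K := Num.max K1 (1 + w / c).
have K0 : 0 < K by rewrite lt_max K10.
pose g x := f (Num.max (- K) (Num.min K x)).
have ug : unif_cont g by exact: clamp_unif_cont.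
have gM x : `|g x| <= M by exact: fM.
have mg : measurable_fun setT g.
  by apply: continuous_measurable_fun; exact: unif_cont_continuous.
have gE x : `|x| <= K -> f x = g x.
  rewrite ler_norml => /andP[Kx xK]; rewrite /g.
  by rewrite (min_idPr xK) (max_idPr Kx).
have e40 : 0 < e / 4 by rewrite divr_gt0.
have /cvgrPdist_le/(_ _ e40) hg := H g M ug gM.
near=> n.
have [A [mA PA AX]] : exists A, [/\ measurable A, (P A <= c%:E)%E &
  forall t, ~ A t -> `|X n t| <= K1] by near: n.
have hn : `|\int[gamma]_y g (Num.sqrt v * y) - \int[P]_t g (X n t)| <= e / 4
  by near: n.
have h1 : `|\int[P]_t f (X n t) - \int[P]_t g (X n t)| <= 0 + 2 * M * c.
  apply: (@Rintegral_dist_off_event _ _ _ P (f \o X n) (g \o X n) A) => //.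
  - exact: measurableT_comp mf (mX n).
  - exact: measurableT_comp mg (mX n).
  - by move=> t; exact: fM.
  - by move=> t; exact: gM.
  - by move=> t nA /=; rewrite -gE ?subrr ?normr0// (le_trans (AX _ nA))// le_max lexx.
have h2 : `|\int[gamma]_y f (Num.sqrt v * y) - \int[gamma]_y g (Num.sqrt v * y)| <= 0 + 2 * M * c.
  apply: (@Rintegral_dist_off_event _ _ _ gamma (fun y => f (Num.sqrt v * y))
    (fun y => g (Num.sqrt v * y)) B) => //.
  - exact: measurableT_comp mf msv.
  - exact: measurableT_comp mg msv.
  - by move=> t nA /=; rewrite -gE ?subrr ?normr0// (le_trans (BG _ nA))// le_max lexx orbT.
move: h1 h2 hn; rewrite !ler_norml.
set x1 := \int[P]_t f _; set x2 := \int[P]_t g _; set x3 := \int[gamma]_y f _;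
  set x4 := \int[gamma]_y g _.
by lra.
Unshelve. all: by end_near. Qed.

End convergence_in_law.

(** * The ridge estimator *)

Section sample_covariance.
Context {T : Type} {R : realType}.
Implicit Types A B : nat -> T -> R.

Lemma smean_affine n A A1 A2 (c b : R) t : (0 < n)%N ->
  (forall i, A i t = c + b * A1 i t + A2 i t) ->
  smean n A t = c + b * smean n A1 t + smean n A2 t.
Proof.
move=> n0 AE; rewrite /smean.
under eq_bigr do rewrite AE.
rewrite !big_split/= sumr_const card_ord -mulr_sumr -mulr_natr.
by field; rewrite pnatr_eq0 -lt0n.
Qed.

Lemma scross_affine n A A1 A2 B (c b : R) t : (0 < n)%N ->
  (forall i, A i t = c + b * A1 i t + A2 i t) ->
  scross n A B t = b * scross n A1 B t + scross n A2 B t.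
Proof.
move=> n0 AE; rewrite /scross (smean_affine n0 AE) mulr_sumr -big_split/=.
by apply: eq_bigr => i _; rewrite AE; ring.
Qed.

(** Sample covariances ignore constants, so variables may be centred at their true means. The sample
    means then survive only in a product, of smaller order when [a] and [b] have mean zero. *)
Lemma scross_shift n A B (a b : nat -> T -> R) (c m : R) t : (0 < n)%N ->
  (forall i, A i t = c + a i t) -> (forall i, B i t = m + b i t) ->
  scross n A B t =
  \sum_(i < n) a i t * b i t - n%:R * (smean n a t * smean n b t).
Proof.
move=> n0 AE BE.
have mE (U u : nat -> T -> R) k : (forall i, U i t = k + u i t) ->
    smean n U t = k + smean n u t.
  move=> UE; rewrite (@smean_affine n U u u k 0)//; first by rewrite mul0r addr0.
  by move=> i; rewrite UE mul0r addr0.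
rewrite /scross (mE A a c)// (mE B b m)//.
have nn0 : (n%:R : R) != 0 by rewrite pnatr_eq0 -lt0n.
have aE : \sum_(i < n) a i t = n%:R * smean n a t
  by rewrite /smean mulrCA divff// mulr1.
have bE : \sum_(i < n) b i t = n%:R * smean n b t
  by rewrite /smean mulrCA divff// mulr1.
move: (smean n a t) (smean n b t) aE bE => sa sb aE bE.
transitivity (\sum_(i < n) (a i t * b i t - sb * a i t - sa * b i t + sa * sb)).
  by apply: eq_bigr => i _; rewrite AE BE; ring.
rewrite !big_split/= !sumrN -!mulr_sumr sumr_const card_ord -(mulr_natr sb) aE bE.
by ring.
Qed.

End sample_covariance.

Section ridge.
Context {d} {T : measurableType d} {R : realType} (P : probability T R).
Variables (eps eta Z : nat -> T -> R) (beta0 beta1 pi0 pi1 : R) (lam : nat -> R).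
Let D := fun i t => pi0 + pi1 * Z i t + eta i t.
Let Y := fun i t => beta0 + beta1 * D i t + eps i t.

Lemma measurable_ridge n : (forall i, measurable_fun setT (eps i)) ->
  (forall i, measurable_fun setT (eta i)) ->
  (forall i, measurable_fun setT (Z i)) ->
  measurable_fun setT (ridge_iv lam Y D Z n).
Proof.
move=> meps meta mZ.
have mD i : measurable_fun setT (D i).
  by apply: measurable_funD => //; apply: measurable_funD => //;
    exact: measurable_funM.
have mY i : measurable_fun setT (Y i).
  by apply: measurable_funD => //; apply: measurable_funD => //;
    exact: measurable_funM.
have msm (A : nat -> T -> R) : (forall i, measurable_fun setT (A i)) ->
    measurable_fun setT (smean n A).
  by move=> mA; apply: measurable_funM => //; exact: measurable_sum.
have msc (A B : nat -> T -> R) : (forall i, measurable_fun setT (A i)) ->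
    (forall i, measurable_fun setT (B i)) -> measurable_fun setT (scross n A B).
  move=> mA mB; apply: measurable_sum => i.
  by apply: measurable_funM; apply: measurable_funB => //; exact: msm.
apply: measurable_funM; first exact: msc.
by apply: measurable_funV; apply: measurable_funD => //; exact: msc.
Qed.

(* [pi1 + b] is the denominator of [ridge_iv - beta1] divided by [n], and
   [S + e] its numerator divided by [sqrt n]. *)
Lemma ridge_error n t (m : R) : (0 < n)%N ->
  let z := fun i t => Z i t - m in
  let r := Num.sqrt n%:R in
  let S := (\sum_(i < n) eps i t * z i t) / r in
  let e := -1 * ((\sum_(i < n) eps i t) / r * smean n z t) + - beta1 * (lam n / r) in
  let b := pi1 * (smean n (fun i t =>
    z i t ^+ 2 - 1) t + -1 * (smean n z t * smean n z t))
    + (smean n (fun i t => eta i t * z i t) t + -1 * (smean n eta t * smean n z t))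
    + lam n / r * r^-1 in
  pi1 + b != 0 -> r * (ridge_iv lam Y D Z n t - beta1) = (S + e) / (pi1 + b).
Proof.
move=> n0 z r S e b pb0.
have nR : 0 < (n%:R : R) by rewrite ltr0n.
have nn0 : (n%:R : R) != 0 by rewrite gt_eqF.
have r0 : r != 0 by rewrite gt_eqF// sqrtr_gt0.
have r2 : r * r = n%:R by rewrite -expr2 sqr_sqrtr// ler0n.
have ZE i : Z i t = m + z i t by rewrite /z addrC subrK.
have epsE i : eps i t = 0 + eps i t by rewrite add0r.
have etaE i : eta i t = 0 + eta i t by rewrite add0r.
have sD : scross n D Z t = pi1 * scross n Z Z t + scross n eta Z t.
  exact: (@scross_affine _ _ n D Z eta Z pi0 pi1).
have sY : scross n Y Z t = beta1 * scross n D Z t + scross n eps Z t.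
  exact: (@scross_affine _ _ n Y D eps Z beta0 beta1).
(* Subtracting 1, which is to be the variance of [Z], separates the leading term from a mean of
   centred variables. *)
have sZZ : scross n Z Z t = n%:R * (1 + (smean n (fun i t => z i t ^+ 2 - 1) t +
    -1 * (smean n z t * smean n z t))).
  rewrite (scross_shift (a := z) (b := z) n0 ZE ZE).
  rewrite {3}/smean sumrB sumr_const card_ord.
  under eq_bigr do rewrite -expr2.
  by field.
have seta : scross n eta Z t = n%:R * (smean n (fun i t => eta i t * z i t) t +
    -1 * (smean n eta t * smean n z t)).
  rewrite (scross_shift (a := eta) (b := z) n0 etaE ZE).
  by rewrite {3}/smean; field.
have seps : scross n eps Z t = \sum_(i < n) eps i t * z i t -
    (\sum_(i < n) eps i t) * smean n z t.
  rewrite (scross_shift (a := eps) (b := z) n0 epsE ZE).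
  by rewrite {1}/smean; field.
have den : scross n D Z t + lam n = n%:R * (pi1 + b).
  rewrite sD sZZ seta /b -mulrA -invfM r2.
  by field.
have den0 : scross n D Z t + lam n != 0 by rewrite den mulf_neq0.
have num : S + e = (scross n eps Z t - beta1 * lam n) / r.
  by rewrite /S /e seps; ring.
rewrite /ridge_iv sY num.
(* [beta1 * scross n D Z t] cancels, and the penalty leaves the shrinkage bias [- beta1 * lam n]. *)
have -> : (beta1 * scross n D Z t + scross n eps Z t) / (scross n D Z t + lam n) - beta1 =
  (scross n eps Z t - beta1 * lam n) / (scross n D Z t + lam n) by field.
rewrite den -r2; move: (pi1 + b) pb0 => q q0.
by field; rewrite r0 q0.
Qed.

End ridge.

(** * The limit law of the estimator *)

Lemma variance_integral {d} {T : measurableType d} {R : realType}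
  (P : probability T R) (X : T -> R) :
  ('V_P[X] = \int[P]_t ((X t - fine 'E_P[X]) ^+ 2)%:E)%E.
Proof. by rewrite /variance !unlock. Qed.

Unset Implicit Arguments.

Theorem mainTheorem3 (d : measure_display) (T : measurableType d) (R : realType)
  (P : probability T R)
  (eps eta Z : nat -> T -> R) (beta0 beta1 pi0 pi1 : R) (lam : nat -> R) :
  (* errors and instruments are random variables *)
  (forall i, measurable_fun setT (eps i)) ->
  (forall i, measurable_fun setT (eta i)) ->
  (forall i, measurable_fun setT (Z i)) ->
  (* the triples (eps_i, eta_i, Z_i) are i.i.d. across i *)
  mutually_independent P (fun i t => (eps i t, eta i t, Z i t)) ->
  identically_distributed P (fun i t => (eps i t, eta i t, Z i t)) ->
  (* instruments independent of the errors *)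
  (forall i, independent2 P (fun t => (eps i t, eta i t)) (Z i)) ->
  (* error moments: mean zero, finite variances (covariance unrestricted) *)
  P.-integrable setT (fun t => (eps 0%N t ^+ 2)%:E) ->
  P.-integrable setT (fun t => (eta 0%N t ^+ 2)%:E) ->
  ('E_P[eps 0%N] = 0)%E ->
  ('E_P[eta 0%N] = 0)%E ->
  (* Assumption B: Var(Z_i) = 1 and finite fourth moment *)
  P.-integrable setT (fun t => (Z 0%N t ^+ 4)%:E) ->
  ('V_P[Z 0%N] = 1)%E ->
  (* strong first stage *)
  pi1 != 0 ->
  (* deterministic nonnegative penalty with lam_n = o(sqrt n) *)
  (forall n, 0 <= lam n) ->
  (lam n / Num.sqrt n%:R) @[n --> \oo] --> (0 : R) ->
  let D := fun i t => pi0 + pi1 * Z i t + eta i t in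
  let Y := fun i t => beta0 + beta1 * D i t + eps i t in
  cvg_in_law_normal0 P
    (fun n t => Num.sqrt n%:R * (ridge_iv lam Y D Z n t - beta1))
    (fine 'V_P[eps 0%N] / pi1 ^+ 2).
Proof.
move=> meps meta mZ iV idV ieZ eps2 eta2 Eeps Eeta Z4 VZ p0 lam0 lamc D Y.
pose V i t := (eps i t, eta i t, Z i t).
have mV i : measurable_fun setT (V i).
  by apply: measurable_fun_pair => //; exact: measurable_fun_pair.
have Eeps0 : \int[P]_t eps 0 t = 0 by move: Eeps; rewrite unlock /Rintegral => ->.
have Eeta0 : \int[P]_t eta 0 t = 0 by move: Eeta; rewrite unlock /Rintegral => ->.
pose m := fine ('E_P[Z 0%N])%E.
have mE : m = \int[P]_t Z 0 t by rewrite /m unlock.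
pose z i t := Z i t - m.
have mz i : measurable_fun setT (z i) by exact: measurable_funB.
have epsi := integrable_sqr (meps 0) eps2.
have etai := integrable_sqr (meta 0) eta2.
have icst (c : R) : P.-integrable setT (EFin \o (fun=> c)).
  by apply: (@bounded_integrable _ _ _ P _ `|c|).
have mZ2 : measurable_fun setT (fun t => Z 0 t ^+ 2) by exact: measurable_funX.
have Z2 : P.-integrable setT (EFin \o (fun t => Z 0 t ^+ 2)).
  by apply: integrable_sqr => //; apply: eq_integrable Z4 => // t _;
    rewrite /= -exprM.
have Zi := integrable_sqr (mZ 0) Z2.
have zi : P.-integrable setT (EFin \o z 0) by exact: integrable_EFinB.
have Ez : \int[P]_t z 0 t = 0 by rewrite RintegralB// Rintegral_prob_cst -mE subrr.
have z4 : P.-integrable setT (EFin \o (fun t => (z 0 t ^+ 2) ^+ 2)).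
  (* Squaring [(x - m)^2 <= 2 x^2 + 2 m^2] and bounding the square of the sum again gives
     [8 x^4 + 8 m^4]. *)
  apply: le_integrable_EFin (integrable_EFinD (integrable_EFinZ 8 Z4)
    (icst (8 * m ^+ 4))).
    by apply: measurable_funX; exact: measurable_funX.
  move=> t; rewrite ger0_norm ?sqr_ge0// /z; move: (Z 0 t) => x.
  have h : (x - m) ^+ 2 <= 2 * x ^+ 2 + 2 * m ^+ 2.
    by have := sqr_ge0 (x + m); nra.
  have x4 : x ^+ 4 = (x ^+ 2) ^+ 2 by rewrite -exprM.
  have m4 : m ^+ 4 = (m ^+ 2) ^+ 2 by rewrite -exprM.
  rewrite x4 m4; have := sqr_ge0 (x - m); have := sqr_ge0 x; have := sqr_ge0 m.
  move: h; move: ((x - m) ^+ 2) (x ^+ 2) (m ^+ 2) => u v w h w0 v0 u0.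
  have h2 : u ^+ 2 <= (2 * v + 2 * w) ^+ 2 by rewrite ler_sqr ?nnegrE//; lra.
  by have := sqr_ge0 (v - w); nra.
have mz2 : measurable_fun setT (fun t => z 0 t ^+ 2) by exact: measurable_funX.
have z2 : P.-integrable setT (EFin \o (fun t => z 0 t ^+ 2)) by exact: integrable_sqr.
have Ez2 : \int[P]_t z 0 t ^+ 2 = 1.
  by move: VZ; rewrite variance_integral /Rintegral => ->.
(* The fourth moment serves here: Chebyshev's inequality for the sample variance of [Z] needs
   [z ^+ 2 - 1] to be square integrable. *)
have c2 : P.-integrable setT (EFin \o (fun t => (z 0 t ^+ 2 - 1) ^+ 2)).
  apply: le_integrable_EFin (integrable_EFinD (integrable_EFinZ 2 z4) (icst 2)).
    by apply: measurable_funX; exact: measurable_funB.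
  move=> t; rewrite ger0_norm ?sqr_ge0//; move: (z 0 t ^+ 2) => u.
  by have := sqr_ge0 (u + 1); nra.
have Ec : \int[P]_t (z 0 t ^+ 2 - 1) = 0.
  by rewrite RintegralB// Ez2 Rintegral_prob_cst subrr.
have ind (u w : R -> R) : measurable_fun setT u -> measurable_fun setT w ->
    independent2 P (u \o eps 0) (w \o Z 0) /\ independent2 P (u \o eta 0) (w \o Z 0).
  move=> mu mw; split.
    exact: (independent2_comp (f :=
      u \o fst) (measurableT_comp mu measurable_fst) mw (ieZ 0)).
  exact: (independent2_comp (f :=
    u \o snd) (measurableT_comp mu measurable_snd) mw (ieZ 0)).
have mw : measurable_fun setT (fun x : R => x - m) by exact: measurable_funB.
have [iez ihz] := ind id _ (@measurable_id _ _ _) mw.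
have mw2 : measurable_fun setT (fun x : R => (x - m) ^+ 2) by exact: measurable_funX.
have [iez2 ihz2] := ind _ _ (@exprn_measurable R setT 2) mw2.
have Eez : \int[P]_t (eps 0 t * z 0 t) = 0.
  by rewrite (independent2_RintegralM iez epsi zi) Ez mulr0.
have Ehz : \int[P]_t (eta 0 t * z 0 t) = 0.
  by rewrite (independent2_RintegralM ihz etai zi) Ez mulr0.
have ez2 : P.-integrable setT (EFin \o (fun t => (eps 0 t * z 0 t) ^+ 2)).
  by apply: eq_integrable (independent2_integrableM iez2 eps2 z2) => // t _;
    rewrite /= exprMn.
have hz2 : P.-integrable setT (EFin \o (fun t => (eta 0 t * z 0 t) ^+ 2)).
  by apply: eq_integrable (independent2_integrableM ihz2 eta2 z2) => // t _;
    rewrite /= exprMn.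
have Eez2 : \int[P]_t (eps 0 t * z 0 t) ^+ 2 = \int[P]_t eps 0 t ^+ 2.
  under eq_Rintegral do rewrite exprMn.
  by rewrite (independent2_RintegralM iez2 eps2 z2) Ez2 mulr1.
have iid (u : R * R * R -> R) : measurable_fun setT u ->
    [/\ forall i, measurable_fun setT (u \o V i),
        mutually_independent P (fun i => u \o V i) &
        identically_distributed P (fun i => u \o V i)].
  move=> mu; split; first by move=> i; exact: measurableT_comp mu (mV i).
    exact: mutually_independent_comp.
  exact: identically_distributed_comp.
have m11 : measurable_fun setT (fun w : R * R * R => w.1.1)
  by exact: measurableT_comp.
have m12 : measurable_fun setT (fun w : R * R * R => w.1.2)
  by exact: measurableT_comp.
have m2 : measurable_fun setT (fun w : R * R * R => w.2 - m)
  by exact: measurable_funB.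
have [meV ieV ideV] := iid _ m11.
have [mhV ihV idhV] := iid _ m12.
have [mzV izV idzV] := iid _ m2.
have [mezV iezV idezV] := iid _ (measurable_funM m11 m2).
have [mhzV ihzV idhzV] := iid _ (measurable_funM m12 m2).
have mc : measurable_fun setT (fun w : R * R * R => (w.2 - m) ^+ 2 - 1).
  by apply: measurable_funB => //; exact: measurable_funX.
have [mcV icV idcV] := iid _ mc.
(* With [pi1^-1] inside the summands, the limiting variance is the second moment of a single
   summand. *)
have mW : measurable_fun setT (fun w : R * R * R => w.1.1 * (w.2 - m) * pi1^-1).
  by apply: measurable_funM => //; exact: measurable_funM.
have [mWV iWV idWV] := iid _ mW.
have oS := Op1_scaled_sum mezV iezV idezV ez2 Eez.
have oeps := Op1_scaled_sum meV ieV ideV eps2 Eeps0.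
have oz := op1_sample_mean mzV izV idzV z2 Ez.
have oeta := op1_sample_mean mhV ihV idhV eta2 Eeta0.
have oetaz := op1_sample_mean mhzV ihzV idhzV hz2 Ehz.
have oz2 := op1_sample_mean mcV icV idcV c2 Ec.
have olam := op1_cst P lamc.
(* [oe] and [ob] reproduce, term by term, the expressions [e] and [b] of [ridge_error]; this is why
   differences there are written with [-1 *]. *)
have oe := op1D (op1Z (-1) (Op1M_op1 oeps oz)) (op1Z (- beta1) olam).
have ob := op1D (op1D
  (op1Z pi1 (op1D oz2 (op1Z (-1) (Op1M_op1 (op1_Op1 oz) oz))))
  (op1D oetaz (op1Z (-1) (Op1M_op1 (op1_Op1 oeta) oz))))
  (Op1M_op1 (op1_Op1 olam) (op1_cst P (@cvg_inv_sqrt_nat R))).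
pose X n t := Num.sqrt n%:R * (ridge_iv lam Y D Z n t - beta1).
have oXS : op1 P (fun n t => X n t -
    (\sum_(i < n) eps i t * z i t) / Num.sqrt n%:R / pi1).
  apply: (op1_ratio p0 oS oe ob).
  near=> n => t; apply: ridge_error.
  by near: n; exact: nbhs_infty_gt.
have mX n : measurable_fun setT (X n).
  apply: measurable_funM => //; apply: measurable_funB => //.
  exact: measurable_ridge.
pose W n t := (Num.sqrt n%:R)^-1 * \sum_(i < n) (eps i t * z i t * pi1^-1).
have WE n t : (\sum_(i < n) eps i t * z i t) / Num.sqrt n%:R / pi1 = W n t.
  by rewrite /W -mulr_suml; ring.
have mWn n : measurable_fun setT (W n).
  by apply: measurable_funM => //; exact: (measurable_partial_sum mWV n).
have oXW : op1 P (fun n t => X n t - W n t).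
  move=> r r0; apply: filterS (oXS r r0) => n [A [mA PA AX]].
  by exists A; split => // t /AX; rewrite WE.
have W2 : P.-integrable setT (EFin \o (fun t => (eps 0 t * z 0 t * pi1^-1) ^+ 2)).
  apply: eq_integrable (integrable_EFinZ (pi1^-1 ^+ 2) ez2) => // t _.
  by rewrite /= [in RHS]exprMn mulrC.
have ezi := independent2_integrableM iez epsi zi.
have EW : \int[P]_t (eps 0 t * z 0 t * pi1^-1) = 0.
  by rewrite RintegralZr// Eez mul0r.
have EW2 : \int[P]_t (eps 0 t * z 0 t * pi1^-1) ^+ 2 = fine ('V_P[eps 0%N])%E / pi1 ^+ 2.
  under eq_Rintegral do rewrite exprMn.
  rewrite RintegralZr// Eez2 exprVn variance_integral Eeps; congr (_ / _).
  by rewrite /Rintegral; congr fine; apply: eq_integral => t _; rewrite subr0.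
have oW : Op1 P W.
  move=> r r0; have [K K0 hK] := Op1_scaled_sum mWV iWV idWV W2 EW r0.
  exists K => //; apply: filterS hK => n [A [mA PA AX]].
  by exists A; split => // t /AX; rewrite /W mulrC.
apply: cvg_in_law_of_unif_cont => //.
  have := Op1D (op1_Op1 oXW) oW.
  move=> h r r0; have [K K0 hK] := h r r0.
  exists K => //; apply: filterS hK => n [A [mA PA AX]].
  by exists A; split => // t /AX; rewrite subrK.
move=> f M uf fM; apply: (slutsky_unif_cont mX mWn oXW uf fM).
by rewrite -EW2; exact: (clt_unif_cont mWV iWV idWV W2 EW uf fM).
Unshelve. all: by end_near. Qed.
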